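(* Let $k \in \{1,2\}$ and let $n > k$ be an integer. For any continuous random vector $X$ in $\mathbb{R}^k$, with $X_1, X_2, \ldots, X_n$ i.i.d. copies of $X$, we have $$P\{\underline{0} \in \mathcal{H}(X_1, X_2, \ldots, X_n)\} \leq P\{\underline{0} \in \mathcal{H}(U_1, U_2, \ldots, U_n)\},$$ where $U_1, \ldots, U_n$ are i.i.d. copies of a random vector $U$ uniformly distributed on the unit sphere in $\mathbb{R}^k$. Further, equality holds if and only if the distribution of the projection $X^p = X/\|X\|_2$ of $X$ on the unit sphere is symmetric with respect to $\underline{0}$.
   Context: $\underline{0}$ denotes the origin of $\mathbb{R}^k$, and $\mathcal{H}(x_1,\ldots,x_n)$ denotes the convex hull of the points $x_1,\ldots,x_n \in \mathbb{R}^k$. A continuous random vector in $\mathbb{R}^k$ is one whose distribution has a density with respect to Lebesgue measure on $\mathbb{R}^k$; in particular $X \neq \underline{0}$ with probability one, so $X^p$ is well defined almost surely. The unit sphere in $\mathbb{R}^k$ is $\{x \in \mathbb{R}^k : \|x\|_2 = 1\}$; for $k=1$ it is $\{-1,1\}$ and $U$ takes each value with probability $1/2$. The distribution of $X^p$ is symmetric with respect to $\underline{0}$ if $X^p$ and $-X^p$ have the same distribution. *)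

(* Defs.v *)
From HB Require Import structures.
From mathcomp Require Import all_boot all_order all_algebra.
From mathcomp Require Import all_classical all_reals all_analysis.

Set Implicit Arguments.
Unset Strict Implicit.
Unset Printing Implicit Defensive.

Import Order.TTheory GRing.Theory Num.Theory.
Import numFieldNormedType.Exports.

Local Open Scope classical_set_scope.
Local Open Scope ring_scope.

Definition measure_rV_display : measure_display -> measure_display.
Proof. exact. Qed.

(* The sigma-algebra on 'rV[T]_n is generated by the coordinate maps; for
   T := R it is the Borel sigma-algebra of R^n. *)
Section measurable_rV.
Context {d} {T : sigmaRingType d}.
Variable n : nat.

Let coors : 'I_n -> 'rV[T]_n -> T := fun i x => x ord0 i.

Let rV_set0 : g_sigma_preimage coors set0.
Proof. exact: sigma_algebra0. Qed.

Let rV_setC A : g_sigma_preimage coors A -> g_sigma_preimage coors (~` A).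
Proof. exact: sigma_algebraC. Qed.

Let rV_bigcup (F : (set 'rV[T]_n)^nat) :
  (forall i, g_sigma_preimage coors (F i)) ->
  g_sigma_preimage coors (\bigcup_i (F i)).
Proof. exact: sigma_algebra_bigcup. Qed.

HB.instance Definition _ := @isMeasurable.Build (measure_rV_display d)
  'rV[T]_n (g_sigma_preimage coors) rV_set0 rV_setC rV_bigcup.

End measurable_rV.

Lemma measurable_coord d (T : sigmaRingType d) n (i : 'I_n) :
  measurable_fun [set: 'rV[T]_n] (fun x : 'rV[T]_n => x ord0 i).
Proof.
move=> _ Y mY; rewrite setTI; apply: sub_sigma_algebra => /=.
rewrite -bigcup_seq/=; exists i => /=; first by rewrite mem_index_enum.
by exists Y => //; rewrite setTI.
Qed.

Lemma measurable_fun_coordP d1 d2 (T1 : measurableType d1)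
    (T2 : measurableType d2) n (f : T1 -> 'rV[T2]_n) :
  measurable_fun [set: T1] f <->
  forall i, measurable_fun [set: T1] (fun x => f x ord0 i).
Proof.
split=> [mf i|mf].
  by apply: (measurableT_comp (f := fun x : 'rV[T2]_n => x ord0 i)) => //;
    exact: measurable_coord.
have : preimage_set_system setT f (@measurable _ 'rV[T2]_n) `<=` measurable.
  rewrite -g_sigma_preimage_comp; apply: smallest_sub.
    exact: sigma_algebra_measurable.
  case: n => [|n] in f mf *; first by rewrite big_ord0.
  rewrite -bigcup_mkord_ord; apply: bigcup_sub => i Ii.
  by move=> A [B mB <-]; exact: mf.
by move=> h _ A mA; apply: h; exists A.
Qed.

Section lebesgue_rV.
Variable R : realType.

Definition cons_rV k (p : R * 'rV[R]_k) : 'rV[R]_k.+1 :=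
  row_mx (p.1)%:M p.2 : 'rV_(1 + k).

Lemma cons_rV0 k (p : R * 'rV[R]_k) : cons_rV p ord0 ord0 = p.1.
Proof.
have := row_mxEl ((p.1)%:M : 'M[R]_1) p.2 ord0 ord0.
rewrite [X in _ = X]mxE eqxx mulr1n => <-.
by rewrite /cons_rV; congr (row_mx _ _ _ _); exact: val_inj.
Qed.

Lemma cons_rVS k (p : R * 'rV[R]_k) i :
  cons_rV p ord0 (lift ord0 i) = p.2 ord0 i.
Proof.
rewrite -(row_mxEr (p.1)%:M p.2).
by rewrite /cons_rV; congr (row_mx _ _ _ _); exact: val_inj.
Qed.

Lemma measurable_cons_rV k : measurable_fun setT (@cons_rV k).
Proof.
apply/measurable_fun_coordP => i; case: (unliftP ord0 i) => [j|] ->.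
  rewrite (_ : (fun _ => _) = (fun x : 'rV[R]_k => x ord0 j) \o snd).
    by apply: measurableT_comp => //; exact: measurable_coord.
  by apply/funext => p /=; rewrite cons_rVS.
rewrite (_ : (fun _ => _) = fst); first exact: measurable_fst.
by apply/funext => p /=; rewrite cons_rV0.
Qed.

Definition lebesgueS k (m : {sigma_finite_measure set 'rV[R]_k -> \bar R}) :
    set 'rV[R]_k.+1 -> \bar R :=
  pushforward (lebesgue_measure \x m)%E (@cons_rV k).

Section lebesgueS_measure.
Variables (k : nat) (m : {sigma_finite_measure set 'rV[R]_k -> \bar R}).

Let lebesgueS0 : lebesgueS m set0 = 0%E.
Proof. by rewrite /lebesgueS /pushforward preimage_set0 measure0. Qed.

Let lebesgueS_ge0 A : (0 <= lebesgueS m A)%E.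
Proof. by rewrite /lebesgueS /pushforward; exact: measure_ge0. Qed.

Let lebesgueS_sigma_additive : semi_sigma_additive (lebesgueS m).
Proof.
move=> F mF tF mUF; rewrite /lebesgueS /pushforward preimage_bigcup.
have mc A : measurable A -> measurable (@cons_rV k @^-1` A).
  by move=> mA; rewrite -[X in measurable X]setTI; exact: measurable_cons_rV.
apply: measure_semi_sigma_additive.
- by move=> n; exact: mc.
- apply/trivIsetP => /= i j _ _ ij; rewrite -preimage_setI.
  by move/trivIsetP : tF => /(_ _ _ _ _ ij) ->//; rewrite preimage_set0.
- by rewrite -preimage_bigcup; exact: mc.
Qed.

HB.instance Definition _ := isMeasure.Build _ _ _ (lebesgueS m)
  lebesgueS0 lebesgueS_ge0 lebesgueS_sigma_additive.

Let lebesgueS_sigma_finite : sigma_finite setT (lebesgueS m).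
Proof.
have /sigma_finiteP[F [FT ndF Foo]] := sigma_finiteT (@lebesgue_measure R).
have /sigma_finiteP[G [GT ndG Goo]] := sigma_finiteT m.
pose u (v : 'rV[R]_k.+1) : R * 'rV[R]_k :=
  (v ord0 ord0, \row_j v ord0 (lift ord0 j)).
have cK : cancel (@cons_rV k) u.
  move=> p; rewrite /u cons_rV0; case: p => a b /=; congr pair.
  by apply/rowP => j; rewrite mxE cons_rVS.
have mu : measurable_fun setT u.
  apply/measurable_fun_pairP; split => /=; first exact: measurable_coord.
  apply/measurable_fun_coordP => i /=.
  by under eq_fun do rewrite mxE; exact: measurable_coord.
exists (fun i => u @^-1` (F i `*` G i)).
  rewrite -preimage_bigcup; apply/esym/seteqP; split=> // v _ /=.
  have [i _ Fi] : (\bigcup_i F i) (u v).1 by rewrite -FT.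
  have [j _ Gj] : (\bigcup_i G i) (u v).2 by rewrite -GT.
  exists (maxn i j) => //; split.
    by move: Fi; exact/subsetPset/ndF/leq_maxl.
  by move: Gj; exact/subsetPset/ndG/leq_maxr.
move=> i; have [mF Fioo] := Foo i; have [mG Gioo] := Goo i; split.
  by rewrite -[X in measurable X]setTI; apply: mu => //; exact: measurableX.
rewrite /lebesgueS /pushforward -comp_preimage.
rewrite (_ : u \o _ = id); last by apply/funext => p /=; rewrite cK.
by rewrite preimage_id product_measure1E// lte_mul_pinfty// ge0_fin_numE.
Qed.

HB.instance Definition _ := Measure_isSigmaFinite.Build _ _ _ (lebesgueS m)
  lebesgueS_sigma_finite.

End lebesgueS_measure.

(* The k-fold product of the Lebesgue measure on R; see lebesgue_rV_box. *)
Fixpoint lebesgue_rV k : {sigma_finite_measure set 'rV[R]_k -> \bar R} :=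
  match k with
  | 0 => \d_(0 : 'rV[R]_0)
  | k'.+1 => lebesgueS (lebesgue_rV k')
  end.

Lemma lebesgue_rV_box k (A : 'I_k -> set R) :
  (forall i, measurable (A i)) ->
  lebesgue_rV k [set v | forall i, A i (v ord0 i)] =
  (\prod_(i < k) lebesgue_measure (A i))%E.
Proof.
elim: k A => [|k IH] A mA.
  by rewrite big_ord0 /= diracE mem_set //= => -[].
rewrite big_ord_recl -IH //= /lebesgueS /pushforward -product_measure1E //.
  congr (_ _); apply/seteqP; split => -[x v] /=.
    move=> h; split=> [|i]; first by have := h ord0; rewrite cons_rV0.
    by have := h (lift ord0 i); rewrite cons_rVS.
  by move=> [h0 h] i; case: (unliftP ord0 i) => [j|] ->;
    rewrite ?cons_rVS ?cons_rV0.
  exact: mA.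
rewrite (_ : (fun _ => _) =
    \bigcap_(i in [set: 'I_k])
      ((fun v : 'rV[R]_k => v ord0 i) @^-1` A (lift ord0 i))).
  apply: fin_bigcap_measurable => // i _.
  by rewrite -[X in measurable X]setTI; exact: measurable_coord.
by apply/seteqP; split => v /= h i; [move=> _|]; exact: h.
Qed.

End lebesgue_rV.

Section convex_hull.
Variable R : realType.

Definition convex_hull k n (x : 'I_n -> 'rV[R]_k) : set 'rV[R]_k :=
  [set y | exists a : 'I_n -> R, [/\ forall i, 0 <= a i,
     \sum_(i < n) a i = 1 & y = \sum_(i < n) a i *: x i]].

(* The library norm `|x| on 'rV[R]_k is the sup norm. *)
Definition norm2 k (x : 'rV[R]_k) : R := Num.sqrt (\sum_(i < k) x ord0 i ^+ 2).

(* With the convention 0^-1 = 0, sphere_proj 0 = 0. *)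
Definition sphere_proj k (x : 'rV[R]_k) : 'rV[R]_k := (norm2 x)^-1 *: x.

End convex_hull.

Section uniform_sphere.
Variable R : realType.

Lemma twopi_gt0 : 0 < 2 * pi :> R.
Proof. by rewrite mulr_gt0 // pi_gt0. Qed.

Definition circle_pt (t : R) : 'rV[R]_2 :=
  \row_(j < 2) if j == ord0 then cos t else sin t.

(* Normalized surface measure of the unit sphere of R^k for k = 1 and k = 2
   (half the counting measure, resp. normalized arc length); the value for
   other k is irrelevant. *)
Definition sphere_law (k : nat) : set 'rV[R]_k -> \bar R :=
  match k return set 'rV[R]_k -> \bar R with
  | 1 => fun A => ((2^-1)%:E * \d_(const_mx 1%R : 'rV[R]_1) A
                 + (2^-1)%:E * \d_(const_mx (-1)%R : 'rV[R]_1) A)%E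
  | 2 => pushforward (uniform_prob twopi_gt0) circle_pt
  | _ => mzero
  end.

End uniform_sphere.

Section random_vectors.
Variables (R : realType) (k : nat).

Definition continuous_random_vector d (T : measurableType d)
    (P : probability T R) (X : {RV P >-> 'rV[R]_k}) : Prop :=
  exists f : 'rV[R]_k -> R, [/\ measurable_fun setT f, forall x, 0 <= f x &
    forall A, measurable A ->
      distribution P X A = (\int[lebesgue_rV R k]_(x in A) (f x)%:E)%E].

Definition uniform_on_sphere d (T : measurableType d)
    (P : probability T R) (U : {RV P >-> 'rV[R]_k}) : Prop :=
  forall A, measurable A -> distribution P U A = sphere_law A.

(* Subfamilies are covered by taking some of the A i to be setT. *)
Definition mutually_independent d (T : measurableType d)
    (P : probability T R) n (Xs : 'I_n -> {RV P >-> 'rV[R]_k}) : Prop :=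
  forall A : 'I_n -> set 'rV[R]_k, (forall i, measurable (A i)) ->
    P (\bigcap_(i in [set: 'I_n]) (Xs i @^-1` A i)) =
    (\prod_(i < n) P (Xs i @^-1` A i))%E.

(* X and the family Xs may live on different probability spaces. *)
Definition iid_copies d (T : measurableType d) (P : probability T R)
    (X : {RV P >-> 'rV[R]_k}) d' (T' : measurableType d')
    (P' : probability T' R) n (Xs : 'I_n -> {RV P' >-> 'rV[R]_k}) : Prop :=
  mutually_independent Xs /\
  forall i A, measurable A -> distribution P' (Xs i) A = distribution P X A.

Definition symmetric_law d (T : measurableType d) (P : probability T R)
    (Y : T -> 'rV[R]_k) : Prop :=
  forall A, measurable A ->
    pushforward P Y A = pushforward P (fun w => - Y w) A.

End random_vectors.

Arguments continuous_random_vector {R k d T} P X.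
Arguments uniform_on_sphere {R k d T} P U.
Arguments mutually_independent {R k d T} P {n} Xs.
Arguments iid_copies {R k d T} P X {d' T'} P' {n} Xs.
Arguments symmetric_law {R k d T} P Y.

(* Main.v *)
From HB Require Import structures.
Require Import Defs.
From mathcomp Require Import all_boot all_order all_algebra.
From mathcomp Require Import all_classical all_reals all_analysis.
From mathcomp Require Import measurable_realfun fingroup perm.
From mathcomp Require Import ring lra.

(** Call [left_mass x] the probability that a copy of [X] falls in the open half-plane to the
    left of the direction [x], that is, of the vectors [y] with [0 < det2 x y].

    In the plane, the origin is outside the hull of the points exactly when the points can be
    swept counterclockwise within less than half a turn, hence when some point has all the
    others to its left ([notin_hullP]). Lines through the origin being null, that point is
    unique up to a null event, and conditioning on it gives
      P(origin not in hull) = n E[left_mass(X)^(n-1)]    ([not_hull_prob]).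
    Of two independent points, either is equally likely to be to the left of the other, so
    left_mass(X) has mean 1/2 ([integral_left_mass]) and convexity of the power bounds the
    right-hand side below by n/2^(n-1) ([left_mass_moment_gap]). As n > 2, the power is
    strictly convex and equality means that left_mass(X) = 1/2 almost surely
    ([left_mass_moment_eq]). The uniform law on the circle is invariant under the half-turn,
    so all its left masses are 1/2 ([uniform_left_mass]) and it attains the bound.

    What remains is to see that left_mass(X) = 1/2 almost surely means symmetry of the
    projection. If the projection is symmetric, opposite half-planes have the same mass
    ([symmetric_left_mass]). Conversely, if left_mass = 1/2 at almost every point for
    the law, then no half-plane at all has more than half of the mass: sweep it from its
    far end; as long as at most one half has been swept the bound holds, and the points met
    later would have a left mass exceeding 1/2, so they carry no mass ([ae_left_mass_le]). Hence
    every half-plane has mass 1/2, opposite sectors have equal masses, and sectors determine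
    the law of the projection ([sphere_proj_symmetric]).

    On the line the origin is outside the hull exactly when all points have the same sign,
    with probability p^n + (1-p)^n where p = P(X > 0), and the same convexity inequality
    applies ([pow_binary_gap]). *)

Set Implicit Arguments.
Unset Strict Implicit.
Unset Printing Implicit Defensive.

Import Order.TTheory GRing.Theory Num.Theory.
Import numFieldNormedType.Exports.

Local Open Scope classical_set_scope.
Local Open Scope ring_scope.

(** * Convex hulls and orientation in the plane *)

(** Certificates for hull membership are small relations between at most three of the
    points. The indices may coincide, so shorter relations are covered as well. *)
Lemma convex_hull_comb3 (R : realType) k n (x : 'I_n -> 'rV[R]_k) i j l (a b c : R) :
  0 <= a -> 0 <= b -> 0 <= c -> 0 < a + b + c ->
  a *: x i + b *: x j + c *: x l = 0 -> convex_hull x 0.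
Proof.
move=> a0 b0 c0 s0 e; pose s := a + b + c.
pose w t : R := a * (t == i)%:R + b * (t == j)%:R + c * (t == l)%:R.
have sumD (V : lmodType R) m (f : 'I_n -> V) : \sum_t (t == m)%:R *: f t = f m.
  rewrite (bigD1 m) //= eqxx scale1r big1 ?addr0 // => t /negPf ->.
  by rewrite scale0r.
have sumw (V : lmodType R) (f : 'I_n -> V) :
    \sum_t w t *: f t = a *: f i + b *: f j + c *: f l.
  rewrite -(sumD _ i f) -(sumD _ j f) -(sumD _ l f) !scaler_sumr -!big_split /=.
  by apply: eq_bigr => t _; rewrite !scalerDl -!scalerA.
exists (fun t => s^-1 * w t); split.
- move=> t; rewrite mulr_ge0 ?invr_ge0 ?(ltW s0) //.
  by rewrite !addr_ge0 // mulr_ge0.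
- rewrite -mulr_sumr; have := sumw R^o (fun=> 1).
  rewrite (eq_bigr w) => [->|t _]; last exact: mulr1.
  by rewrite !{1}/GRing.scale /= !mulr1 mulVf // gt_eqF.
- under eq_bigr do rewrite -scalerA.
  by rewrite -scaler_sumr sumw e scaler0.
Qed.

Section plane_geometry.
Variable R : realType.
Implicit Types x y z : 'rV[R]_2.

Definition det2 x y : R := x ord0 ord0 * y ord0 ord_max - x ord0 ord_max * y ord0 ord0.
Definition dot2 x y : R := x ord0 ord0 * y ord0 ord0 + x ord0 ord_max * y ord0 ord_max.

(** The angle from [x] counterclockwise to [y] is at least 0 and less than [pi]. *)
Definition ccw x y := (0 < det2 x y) || ((det2 x y == 0) && (0 < dot2 x y)).

Lemma rV2P x y : x ord0 ord0 = y ord0 ord0 -> x ord0 ord_max = y ord0 ord_max -> x = y.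
Proof.
move=> e0 e1; apply/rowP => -[[|[|//]] h].
  by rewrite (_ : Ordinal h = ord0) //; exact: val_inj.
by rewrite (_ : Ordinal h = ord_max) //; exact: val_inj.
Qed.

Lemma det2xx x : det2 x x = 0.
Proof. rewrite /det2; ring. Qed.

Lemma det2C x y : det2 y x = - det2 x y.
Proof. rewrite /det2; ring. Qed.

Lemma det2N x y : det2 (- x) y = - det2 x y.
Proof. rewrite /det2 !mxE; ring. Qed.

Lemma det2Zr x a y : det2 x (a *: y) = a * det2 x y.
Proof. rewrite /det2 !mxE; ring. Qed.

Lemma det2_suml n x (a : 'I_n -> R) (y : 'I_n -> 'rV[R]_2) :
  det2 x (\sum_(i < n) a i *: y i) = \sum_(i < n) a i * det2 x (y i).
Proof.
rewrite /det2 !summxE !mulr_sumr -sumrB; apply: eq_bigr => i _; rewrite !mxE; ring.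
Qed.

Lemma dot2_suml n x (a : 'I_n -> R) (y : 'I_n -> 'rV[R]_2) :
  dot2 x (\sum_(i < n) a i *: y i) = \sum_(i < n) a i * dot2 x (y i).
Proof.
rewrite /dot2 !summxE !mulr_sumr -big_split /=; apply: eq_bigr => i _; rewrite !mxE; ring.
Qed.

Lemma dot2xx_ge0 x : 0 <= dot2 x x.
Proof. by rewrite /dot2 addr_ge0 // -expr2 sqr_ge0. Qed.

Lemma dot2xx_gt0 x : x != 0 -> 0 < dot2 x x.
Proof.
move=> x0; rewrite lt_def dot2xx_ge0 andbT; apply: contra x0.
rewrite /dot2 -!expr2 paddr_eq0 ?sqr_ge0 // !sqrf_eq0 => /andP[/eqP e0 /eqP e1].
by apply/eqP/rV2P; rewrite mxE.
Qed.

(** Cramer's rule for three vectors of the plane; up to a factor, it gives the barycentric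
    coordinates of the origin in the triangle [x y z]. *)
Lemma det2_cycle x y z : det2 y z *: x + det2 z x *: y + det2 x y *: z = 0.
Proof. by apply: rV2P; rewrite /det2 !mxE; ring. Qed.

Lemma dot2_relation x y : det2 x y = 0 -> dot2 y y *: x + (- dot2 x y) *: y = 0.
Proof.
move=> h; apply: rV2P; rewrite !mxE.
  transitivity (det2 x y * y ord0 ord_max); last by rewrite h mul0r.
  by rewrite /dot2 /det2; ring.
transitivity (- (det2 x y * y ord0 ord0)); last by rewrite h mul0r oppr0.
by rewrite /dot2 /det2; ring.
Qed.

Section hull.
Variables (n : nat) (x : 'I_n -> 'rV[R]_2).

(** A point from which all others are seen counterclockwise prevents the origin from being
    a convex combination: the determinant against [x i] kills the weights off the ray of
    [x i], the scalar product then kills those on the ray. *)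
Lemma ccw_notin_hull i : (forall j, ccw (x i) (x j)) -> ~ convex_hull x 0.
Proof.
move=> h [a [a0 a1 e]].
have det0 j : a j * det2 (x i) (x j) = 0.
  have : \sum_j a j * det2 (x i) (x j) == 0.
    by rewrite -det2_suml -e /det2 !mxE !mulr0 subr0.
  rewrite psumr_eq0 => [/allP /(_ j)|l _]; first by rewrite mem_index_enum => /(_ isT)/eqP.
  by rewrite mulr_ge0 //; case/orP: (h l) => [/ltW//|/andP[/eqP -> _]].
have dot0 j : a j * dot2 (x i) (x j) = 0.
  have : \sum_j a j * dot2 (x i) (x j) == 0.
    by rewrite -dot2_suml -e /dot2 !mxE !mulr0 addr0.
  rewrite psumr_eq0 => [/allP /(_ j)|l _]; first by rewrite mem_index_enum => /(_ isT)/eqP.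
  case/orP: (h l) => [d|/andP[_ d]]; last by rewrite mulr_ge0 // ltW.
  by move: (det0 l) => /eqP; rewrite mulf_eq0 (gt_eqF d) orbF => /eqP ->; rewrite mul0r.
have : \sum_j a j = 0.
  apply: big1 => j _; case/orP: (h j) => [d|/andP[_ d]].
    by move: (det0 j) => /eqP; rewrite mulf_eq0 (gt_eqF d) orbF => /eqP.
  by move: (dot0 j) => /eqP; rewrite mulf_eq0 (gt_eqF d) orbF => /eqP.
by move/eqP; rewrite a1 oner_eq0.
Qed.

Hypothesis x_out : ~ convex_hull x 0.

Lemma notin_hull_neq0 i : x i != 0.
Proof.
apply/eqP => xi0; apply: x_out.
by apply: (@convex_hull_comb3 _ _ _ x i i i 1 0 0);
  rewrite ?xi0 ?scaler0 ?addr0 // ltr01.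
Qed.

Lemma notin_hull_dot i j : det2 (x i) (x j) = 0 -> 0 < dot2 (x i) (x j).
Proof.
move=> d; rewrite ltNge; apply/negP => dle; apply: x_out.
have xj := dot2xx_gt0 (notin_hull_neq0 j).
apply: (@convex_hull_comb3 _ _ _ x i j j (dot2 (x j) (x j)) (- dot2 (x i) (x j)) 0);
  rewrite ?oppr_ge0 ?dot2xx_ge0 // ?addr0.
  by rewrite ltr_wpDr // oppr_ge0.
by rewrite scale0r addr0 dot2_relation.
Qed.

Lemma notin_hull_ccw i j : ccw (x i) (x j) = (0 <= det2 (x i) (x j)).
Proof.
rewrite /ccw le_eqVlt eq_sym orbC; case: eqP => //= d.
by rewrite notin_hull_dot.
Qed.

(** When transitivity fails, the three points surround the origin. *)
Lemma notin_hull_ccw_trans i j k :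
  ccw (x i) (x j) -> ccw (x j) (x k) -> ccw (x i) (x k).
Proof.
rewrite !notin_hull_ccw => dij djk; rewrite leNgt; apply/negP => dik.
have dki : 0 < det2 (x k) (x i) by rewrite det2C oppr_gt0.
apply: x_out; apply: (convex_hull_comb3 _ _ _ _ (det2_cycle (x i) (x j) (x k))) => //.
  exact: ltW.
by rewrite ltr_wpDr // ltr_wpDl.
Qed.

(** Outside the hull, [ccw] is a total preorder on the points, so it has an extreme
    element; the proof takes a point with the largest number of successors. *)
Lemma notin_hull_extreme : (0 < n)%N -> exists i, forall j, ccw (x i) (x j).
Proof.
move=> n0; pose out i := #|[pred j | ccw (x i) (x j)]|.
have [i _ imax] := @arg_maxnP _ (Ordinal n0) xpredT out isT.
exists i => j; case: (boolP (ccw (x i) (x j))) => // nij.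
have dji : 0 < det2 (x j) (x i).
  by rewrite det2C oppr_gt0 ltNge; move: nij; rewrite notin_hull_ccw.
have ji : ccw (x j) (x i) by rewrite /ccw dji.
suff /leq_trans/(_ (imax j isT)) : (out i < out j)%N by rewrite ltnn.
apply: proper_card; apply/fintype.properP; split.
  by apply/fintype.subsetP => l; rewrite !inE; exact: notin_hull_ccw_trans.
by exists j; rewrite !inE // notin_hull_ccw det2xx.
Qed.
End hull.

(** No general position is assumed, so this also gives the measurability of the event. *)
Lemma notin_hullP n (x : 'I_n -> 'rV[R]_2) : (0 < n)%N ->
  ~ convex_hull x 0 <-> exists i, forall j, ccw (x i) (x j).
Proof.
move=> n0; split=> [h|[i hi]]; first exact: notin_hull_extreme.
exact: ccw_notin_hull hi.
Qed.

End plane_geometry.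

(** * Independent copies and Fubini's theorem *)

Section independence.
Variables (R : realType) (k : nat).
Local Notation V := 'rV[R]_k.

(** Boxes form a pi-system generating the product sigma-algebra. *)
Lemma measurable_rV_unique n (m1 m2 : {measure set 'rV[V]_n -> \bar R}) :
    (m1 setT < +oo)%E ->
    (forall C : 'I_n -> set V, (forall j, measurable (C j)) ->
      m1 [set v | forall j, C j (v ord0 j)] = m2 [set v | forall j, C j (v ord0 j)]) ->
  forall A, measurable A -> m1 A = m2 A.
Proof.
move=> m1oo m12.
pose G := [set A : set 'rV[V]_n | exists2 C : 'I_n -> set V,
  forall j, measurable (C j) & A = [set v | forall j, C j (v ord0 j)]].
have GT : G setT by exists (fun=> setT) => //; apply/seteqP; split.
apply: (measure_unique G (fun=> setT)) => //.
- apply/seteqP; split.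
    apply: smallest_sub; first exact: smallest_sigma_algebra.
    apply: subset_trans (@sub_gen_smallest _ _ _).
    rewrite -bigcup_seq => A [i _ [B mB <-]].
    exists (fun j => if j == i then B else setT).
      by move=> j; case: ifP.
    apply/seteqP; split => [v [_ /= Bv] j|v /= /(_ i)]; last by rewrite eqxx.
    by case: eqP => // ->.
  apply: smallest_sub; first exact: sigma_algebra_measurable.
  move=> A [C mC ->].
  rewrite [X in measurable X](_ : _ = \bigcap_(i in [set: 'I_n])
      ((fun v : 'rV[V]_n => v ord0 i) @^-1` C i)).
    apply: fin_bigcap_measurable => // i _.
    by rewrite -[X in measurable X]setTI; apply: measurable_coord.
  by apply/seteqP; split => v /= h i; [move=> _|]; exact: h.
- move=> A B [C mC ->] [D mD ->]; exists (fun j => C j `&` D j).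
    by move=> j; exact: measurableI.
  by apply/seteqP; split => [v [c d] j|v cd]; split => // j; case: (cd j).
- by apply/seteqP; split => // v _; exists 0%N.
- by move=> A [C mC ->]; exact: m12.
Qed.

Context d (T : measurableType d) (P : probability T R).
Variable mu : probability V R.

Definition iid_law n (Y : 'I_n -> {RV P >-> V}) :=
  mutually_independent P Y /\
  forall i A, measurable A -> P (Y i @^-1` A) = mu A.

Lemma iid_law_prod n (Y : 'I_n -> {RV P >-> V}) A : iid_law Y ->
  (forall i, measurable (A i)) ->
  P [set w | forall i, A i (Y i w)] = (\prod_(i < n) mu (A i))%E.
Proof.
move=> [ind law] mA; rewrite -(eq_bigr _ (fun i _ => law i _ (mA i))) -ind //.
by congr (P _); apply/seteqP; split => w /= h i; [move=> _|]; exact: h.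
Qed.

Lemma iid_law_perm n (Y : 'I_n -> {RV P >-> V}) (s : {perm 'I_n}) :
  iid_law Y -> iid_law (fun i => Y (s i)).
Proof.
move=> [ind law]; split=> [A mA|i A mA]; last exact: law.
rewrite (reindex_inj (@perm_inj _ s^-1%g)) /=.
under eq_bigr do rewrite permKV.
rewrite -(ind (fun i => A (s^-1%g i))) //; congr (P _).
apply/seteqP; split => w /= h i _; first by have := h (s^-1%g i) Logic.I; rewrite permKV.
by have := h (s i) Logic.I; rewrite permK.
Qed.

Section split_first.
Variables (m : nat) (Y : 'I_m.+1 -> {RV P >-> V}).
Hypothesis iidY : iid_law Y.

Let tail (w : T) : 'rV[V]_m := \row_j Y (lift ord0 j) w.

Let measurable_tail : measurable_fun setT tail.
Proof.
apply/measurable_fun_coordP => j; rewrite (_ : (fun _ => _) = Y (lift ord0 j)) //.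
by apply/funext => w; rewrite mxE.
Qed.

HB.instance Definition _ := isMeasurableFun.Build _ _ _ _ tail measurable_tail.

Let head_tail (w : T) : V * 'rV[V]_m := (Y ord0 w, tail w).

Let measurable_head_tail : measurable_fun setT head_tail.
Proof. by apply/measurable_fun_pairP; split. Qed.

HB.instance Definition _ :=
  isMeasurableFun.Build _ _ _ _ head_tail measurable_head_tail.

Let tail_box C : (forall j, measurable (C j)) ->
  P [set w | forall j, C j (tail w ord0 j)] = (\prod_(j < m) mu (C j))%E.
Proof.
move=> mC; pose D i := if unlift ord0 i is Some j then C j else setT.
have mD i : measurable (D i) by rewrite /D; case: unliftP.
have := iid_law_prod iidY mD.
rewrite big_ord_recl {2}/D unlift_none probability_setT mul1e.
rewrite (eq_bigr (fun j => mu (C j))) => [<-|j _]; last by rewrite /D liftK.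
congr (P _); apply/seteqP; split => w /= h i.
  by rewrite /D; case: unliftP => // j ->; have := h j; rewrite mxE.
by have := h (lift ord0 i); rewrite /D liftK mxE.
Qed.

(** The independence of the family is only postulated on boxes. The passage to arbitrary
    measurable sets [B] of tails is by uniqueness of measures, the first vector being
    confined to a fixed set [A]. *)
Lemma head_tail_law E : measurable E ->
  P (head_tail @^-1` E) = (mu \x distribution P tail)%E E.
Proof.
move=> mE; rewrite -[LHS]/(distribution P head_tail E).
apply/esym; apply: product_measure_unique => // A B mA mB.
rewrite -[LHS]/(P ((Y ord0 @^-1` A) `&` (tail @^-1` B))) setIC.
have mYA : measurable (Y ord0 @^-1` A) by exact: measurable_funPTI.
have muA_fin : (mu A \is a fin_num)%E by exact: fin_num_measure.
have r0 : 0 <= fine (mu A) by exact: fine_ge0.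
(* The structure of the pushforward is given by name, because the measurability proof it
   depends on cannot be found by unification. *)
pose m1 : {measure set 'rV[V]_m -> \bar R} :=
  measure_function_pushforward__canonical__measure_function_Measure
    (mrestr P mYA) measurable_tail.
pose m2 : {measure set 'rV[V]_m -> \bar R} :=
  mscale (NngNum r0) (distribution P tail).
have m2E C : m2 C = (mu A * P (tail @^-1` C))%E
  by rewrite -[LHS]/((fine (mu A))%:E * P (tail @^-1` C))%E fineK.
rewrite -[RHS]m2E -[LHS]/(m1 B); apply: measurable_rV_unique => // [|C mC].
  rewrite -[X in (X < _)%E]/(P (setT `&` _)) setTI.
  by rewrite (le_lt_trans (probability_le1 _ mYA)) ?ltry.
rewrite m2E -[LHS]/(P ([set w | forall j, C j (tail w ord0 j)] `&` _)).
rewrite -[X in (_ * P X)%E]/[set w | forall j, C j (tail w ord0 j)] tail_box //.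
pose D i := if unlift ord0 i is Some j then C j else A.
have mD i : measurable (D i) by rewrite /D; case: unliftP.
have := iid_law_prod iidY mD.
rewrite big_ord_recl {2}/D unlift_none.
rewrite [in RHS](eq_bigr (fun j => mu (C j))) => [<-|j _]; last by rewrite /D liftK.
congr (P _); apply/seteqP; split => w /=.
  move=> [c a] i; rewrite /D; case: unliftP => [j|] -> //.
  by have := c j; rewrite mxE.
move=> h; split=> [j|]; last by have := h ord0; rewrite /D unlift_none.
by have := h (lift ord0 j); rewrite /D liftK mxE.
Qed.

(** Conditioning on the first vector: given [Y ord0 = x], the other vectors are
    independent, and each falls in the section of [S] at [x] with the same probability. *)
Lemma head_all_tail_prob (S : set (V * V)) : measurable S ->
  P [set w | forall j, S (Y ord0 w, Y (lift ord0 j) w)] =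
  (\int[mu]_x ((fine (mu (xsection S x))) ^+ m)%:E)%E.
Proof.
move=> mS; pose E := [set p : V * 'rV[V]_m | forall j, S (p.1, p.2 ord0 j)].
have mE : measurable E.
  rewrite (_ : E = \bigcap_(j in [set: 'I_m])
      ((fun p : V * 'rV[V]_m => (p.1, p.2 ord0 j)) @^-1` S)).
    apply: fin_bigcap_measurable => // j _.
    rewrite -[X in measurable X]setTI.
    have mp : measurable_fun setT (fun p : V * 'rV[V]_m => (p.1, p.2 ord0 j)).
      apply/measurable_fun_pairP; split; first exact: measurable_fst.
      by apply: (measurableT_comp (f := fun v : 'rV[V]_m => v ord0 j)) => //;
        exact: measurable_coord.
    exact: mp.
  by apply/seteqP; split => v /= h i; [move=> _|]; exact: h.
rewrite (_ : mkset _ = head_tail @^-1` E).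
  rewrite head_tail_law // /product_measure1; apply: eq_integral => x _ /=.
  rewrite -[LHS]/(P (tail @^-1` (xsection E x))).
  transitivity (\prod_(j < m) mu (xsection S x))%E.
    rewrite -tail_box => [|j]; last exact: measurable_xsection.
    congr (P _); apply/seteqP; split => w /=.
      by move=> h j; apply/mem_set; exact: set_mem h j.
    by move=> h; apply/mem_set => j; exact: set_mem (h j).
  rewrite -[in LHS](fineK (fin_num_measure _ _ _)) ?prodEFin ?prodr_const ?card_ord //.
  exact: measurable_xsection.
by apply/seteqP; split => w /= h j; have := h j; rewrite mxE.
Qed.

End split_first.

(** Exchangeability lets any of the vectors play the role of the first one. *)
Lemma pivot_all_others_prob m (Y : 'I_m.+1 -> {RV P >-> V}) i (S : set (V * V)) :
  iid_law Y -> measurable S ->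
  P [set w | forall j, j != i -> S (Y i w, Y j w)] =
  (\int[mu]_x ((fine (mu (xsection S x))) ^+ m)%:E)%E.
Proof.
move=> iidY mS; rewrite -(head_all_tail_prob (iid_law_perm (tperm ord0 i) iidY)) //.
congr (P _); apply/seteqP; split => w /= h j.
  by rewrite tpermL; apply: h; rewrite -(inj_eq (@perm_inj _ (tperm ord0 i))) tpermK tpermR.
move=> ji; have : tperm ord0 i j != ord0.
  by rewrite -(inj_eq (@perm_inj _ (tperm ord0 i))) tpermK tpermL.
case: (unliftP ord0 (tperm ord0 i j)) => [l e _|->]; last by rewrite eqxx.
by have := h l; rewrite tpermL -e tpermK.
Qed.

End independence.

(** * Moments of the mass to the left of a random point *)

(** The convex function [x |-> x ^+ m.+2] lies above its tangent at [b]; the quadratic gap is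
    what settles the case of equality. All terms are nonnegative, so that the inequality can
    be integrated without integrability conditions. *)
Lemma pow_tangent_gap (R : realFieldType) (m : nat) (a b : R) : 0 <= a -> 0 <= b ->
  m.+2%:R * b ^+ m.+1 * a + b ^+ m * (a - b) ^+ 2 <=
  a ^+ m.+2 + m.+1%:R * b ^+ m.+2.
Proof.
move=> a0 b0; elim: m => [|m IH].
  rewrite !expr2 !expr1 expr0; nra.
rewrite -subr_ge0 in IH.
have h1 := mulr_ge0 a0 IH.
have gap0 l : 0 <= b ^+ l * (a - b) ^+ 2 := mulr_ge0 (exprn_ge0 l b0) (sqr_ge0 _).
have h2 := mulr_ge0 a0 (gap0 m).
have h3 := mulr_ge0 (ler0n R m.+1) (gap0 m.+1).
rewrite -subr_ge0; apply: le_trans (addr_ge0 (addr_ge0 h1 h2) h3) _.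
rewrite le_eqVlt; apply/orP; left; apply/eqP.
rewrite ![_ ^+ m.+3]exprS ![_ ^+ m.+2]exprS ![_ ^+ m.+1]exprS -!natr1; ring.
Qed.

Section measurable_sets.
Variable R : realType.
Context d (T : measurableType d).

Lemma measurable_bool_set (b : T -> bool) :
  measurable_fun setT b -> measurable [set t | b t].
Proof.
move=> mb; rewrite (_ : [set t | b t] = setT `&` b @^-1` [set true]); first exact: mb.
by rewrite setTI; apply/seteqP; split => t /=.
Qed.

Variables f g : T -> 'rV[R]_2.
Hypotheses (mf : measurable_fun setT f) (mg : measurable_fun setT g).

Lemma measurable_det2 : measurable_fun setT (fun t => det2 (f t) (g t)).
Proof.
have /measurable_fun_coordP cf := mf; have /measurable_fun_coordP cg := mg.
by apply: measurable_funB; apply: measurable_funM.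
Qed.

Lemma measurable_dot2 : measurable_fun setT (fun t => dot2 (f t) (g t)).
Proof.
have /measurable_fun_coordP cf := mf; have /measurable_fun_coordP cg := mg.
by apply: measurable_funD; apply: measurable_funM.
Qed.

Lemma measurable_det2_gt0 : measurable [set t | 0 < det2 (f t) (g t)].
Proof.
by apply: measurable_bool_set; apply: measurable_fun_ltr => //; exact: measurable_det2.
Qed.

Lemma measurable_det2_lt0 : measurable [set t | det2 (f t) (g t) < 0].
Proof.
by apply: measurable_bool_set; apply: measurable_fun_ltr => //; exact: measurable_det2.
Qed.

Lemma measurable_det2_eq0 : measurable [set t | det2 (f t) (g t) = 0].
Proof.
rewrite (_ : [set _ | _] = [set t | det2 (f t) (g t) == 0]).
  by apply: measurable_bool_set; apply: measurable_fun_eqr => //; exact: measurable_det2.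
by apply/seteqP; split => t /= /eqP.
Qed.

Lemma measurable_ccw : measurable [set t | ccw (f t) (g t)].
Proof.
apply: measurable_bool_set; apply: measurable_or.
  by apply: measurable_fun_ltr => //; exact: measurable_det2.
apply: measurable_and.
  by apply: measurable_fun_eqr => //; exact: measurable_det2.
by apply: measurable_fun_ltr => //; exact: measurable_dot2.
Qed.

End measurable_sets.

Lemma measurable_opp_rV (R : realType) k :
  measurable_fun setT (fun v : 'rV[R]_k => - v).
Proof.
apply/measurable_fun_coordP => i; under eq_fun do rewrite mxE.
by apply: measurableT_comp => //; exact: measurable_coord.
Qed.

Section planar_law.
Variables (R : realType) (mu : probability 'rV[R]_2 R).
Local Notation V := 'rV[R]_2.
Implicit Types x y : V.

Definition half_plane x : set V := [set y | 0 < det2 x y].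

Definition left_mass x : R := fine (mu (half_plane x)).

Lemma measurable_half_plane x : measurable (half_plane x).
Proof. by apply: measurable_det2_gt0 => //; exact: measurable_cst. Qed.
Hint Resolve measurable_half_plane : core.

Lemma measurable_line x : measurable [set y | det2 x y = 0].
Proof.
by apply: (measurable_det2_eq0 (f := cst x) (g := id)) => //; exact: measurable_cst.
Qed.
Hint Resolve measurable_line : core.

Lemma left_massE x : mu (half_plane x) = (left_mass x)%:E.
Proof. by rewrite fineK // fin_num_measure. Qed.

Lemma left_mass_ge0 x : 0 <= left_mass x.
Proof. exact: fine_ge0. Qed.

Lemma left_mass_le1 x : left_mass x <= 1.
Proof. by rewrite -lee_fin -left_massE probability_le1. Qed.

Definition left_pairs : set (V * V) := [set p | 0 < det2 p.1 p.2].

Lemma measurable_left_pairs : measurable left_pairs.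
Proof. by apply: measurable_det2_gt0; [exact: measurable_fst|exact: measurable_snd]. Qed.

Lemma xsection_left_pairs x : xsection left_pairs x = half_plane x.
Proof.
apply/seteqP; split => y h; first exact: set_mem h.
exact: (@mem_set _ left_pairs (x, y) h).
Qed.

Lemma measurable_left_mass : measurable_fun setT left_mass.
Proof.
have := measurable_fun_xsection mu measurable_left_pairs.
move=> h; rewrite (_ : left_mass = fine \o (mu \o xsection left_pairs)).
  by apply: measurableT_comp => //; exact: fine_measurable.
by apply/funext => x; rewrite /= xsection_left_pairs.
Qed.

Definition null_lines := forall x, x != 0 -> mu [set y | det2 x y = 0] = 0%E.

Hypothesis mu_lines : null_lines.

Lemma measurable_origin : measurable [set (0 : V)].
Proof.
rewrite (_ : [set 0] = [set y | det2 (const_mx 1) y = 0] `&`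
                       [set y | det2 (\row_j (j == ord0)%:R) y = 0]).
  exact: measurableI.
apply/seteqP; split => [y -> /=|y [/= d1 d2]].
  by rewrite /det2 !mxE; split; ring.
move: d1 d2; rewrite /det2 !mxE /= mul1r mul0r subr0 !mul1r => /eqP + y1.
by rewrite y1 sub0r oppr_eq0 => /eqP y0; apply: rV2P; rewrite mxE.
Qed.

Lemma null_origin : mu [set 0] = 0%E.
Proof.
have e0 : (const_mx 1 : V) != 0.
  by apply/eqP => /rowP /(_ ord0) /eqP; rewrite !mxE oner_eq0.
apply/eqP; rewrite -measure_le0 -(mu_lines e0).
apply: le_measure; [apply/mem_set; exact: measurable_origin|exact/mem_set|].
by move=> y -> /=; rewrite /det2 !mxE; ring.
Qed.

Lemma ae_neq0 : {ae mu, forall x, x != 0}.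
Proof.
exists [set 0]; split; [exact: measurable_origin|exact: null_origin|].
by move=> x /= /negP; rewrite negbK => /eqP.
Qed.

Lemma left_massN x : x != 0 -> left_mass x + left_mass (- x) = 1.
Proof.
move=> x0; apply: EFin_inj; rewrite EFinD -!left_massE -(probability_setT mu).
rewrite (_ : setT = half_plane x `|` (half_plane (- x) `|` [set y | det2 x y = 0])).
  have d2 : half_plane (- x) `&` [set y | det2 x y = 0] = set0.
    apply/seteqP; split => // y [/=]; rewrite /half_plane /= det2N => + d.
    by rewrite d oppr0 ltxx.
  have d1 : half_plane x `&` (half_plane (- x) `|` [set y | det2 x y = 0]) = set0.
    apply/seteqP; split => // y [/=]; rewrite /half_plane /= det2N => d [|e].
      by rewrite oppr_gt0 ltNge (ltW d).
    by rewrite e ltxx in d.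
  rewrite measureU //; last exact: measurableU.
  by congr (_ + _)%E; rewrite measureU // [X in (_ + X)%E](mu_lines x0) adde0.
apply/seteqP; split => // y _ /=; rewrite /half_plane /= det2N oppr_gt0.
by case: (ltgtP (det2 x y) 0); [right; left|left|right; right].
Qed.


(** Exchanging the two points of a pair reverses its orientation. *)
Lemma integral_left_massN :
  (\int[mu]_x (left_mass (- x))%:E = \int[mu]_x (left_mass x)%:E)%E.
Proof.
pose S := [set p : V * V | det2 p.1 p.2 < 0].
have mS : measurable S.
  by apply: measurable_det2_lt0; [exact: measurable_fst|exact: measurable_snd].
have -> : (\int[mu]_x (left_mass (- x))%:E = (mu \x mu) S)%E.
  rewrite /product_measure1; apply: eq_integral => x _ /=.
  rewrite -left_massE; congr (mu _); apply/seteqP; split => y /=.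
    by rewrite /half_plane /= det2N oppr_gt0 => h; apply: (@mem_set _ S (x, y)).
  by move=> /set_mem; rewrite /half_plane /= det2N oppr_gt0.
have -> : ((mu \x mu) S = (mu \x^ mu) S)%E.
  by apply: product_measure_unique => // A B mA mB; exact: product_measure2E.
rewrite /product_measure2; apply: eq_integral => y _ /=.
rewrite -left_massE; congr (mu _); apply/seteqP; split => x /=.
  by move=> /set_mem; rewrite /half_plane /S /= det2C oppr_lt0.
by rewrite /half_plane /= det2C oppr_gt0 => h; apply: (@mem_set _ S (x, y)).
Qed.

Lemma measurable_left_massN : measurable_fun setT (fun x => left_mass (- x)).
Proof.
apply: (measurableT_comp measurable_left_mass).
exact: measurable_opp_rV.
Qed.

(** Of two independent points, each is to the left of the other with the same
    probability. *)
Lemma integral_left_mass : (\int[mu]_x (left_mass x)%:E = (2^-1)%:E)%E.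
Proof.
set I := LHS.
have : (I + I = 1)%E.
  rewrite -[X in (_ + X)%E]integral_left_massN -ge0_integralD //.
  - transitivity (\int[mu]_x (cst 1 x))%E; last first.
      by rewrite integral_cst //= probability_setT mule1.
    apply: ge0_ae_eq_integral => //.
    + apply: emeasurable_funD; apply/measurable_EFinP.
        exact: measurable_left_mass.
      exact: measurable_left_massN.
    + by move=> x _; rewrite -EFinD lee_fin addr_ge0 // left_mass_ge0.
    + by apply: filterS ae_neq0 => x x0 _; rewrite -EFinD left_massN.
  - by move=> x _; rewrite lee_fin left_mass_ge0.
  - by apply/measurable_EFinP; exact: measurable_left_mass.
  - by move=> x _; rewrite lee_fin left_mass_ge0.
  - by apply/measurable_EFinP; exact: measurable_left_massN.
case: I => [r| |] //; rewrite -EFinD => -[r1]; congr EFin; lra.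
Qed.

Lemma integral_unit_fin_num (f : V -> R) : measurable_fun setT f ->
  (forall x, 0 <= f x <= 1) -> (\int[mu]_x (f x)%:E \is a fin_num)%E.
Proof.
move=> mf f01; have f0 x : (0 <= (f x)%:E)%E by rewrite lee_fin; case/andP: (f01 x).
rewrite ge0_fin_numE; last exact: integral_ge0.
apply: (@le_lt_trans _ _ (\int[mu]_x (cst 1 x))%E).
  apply: ge0_le_integral => //; first exact/measurable_EFinP.
  by move=> x _; rewrite lee_fin; case/andP: (f01 x).
by rewrite integral_cst //= probability_setT mule1 ltry.
Qed.

Lemma measurable_left_massX m : measurable_fun setT (fun x => left_mass x ^+ m).
Proof. by apply: measurable_funX; exact: measurable_left_mass. Qed.

Lemma measurable_left_mass_var :
  measurable_fun setT (fun x => (left_mass x - 2^-1) ^+ 2).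
Proof.
by apply: measurable_funX; apply: measurable_funB => //; exact: measurable_left_mass.
Qed.

Lemma left_massX_fin_num m : (\int[mu]_x (left_mass x ^+ m)%:E \is a fin_num)%E.
Proof.
apply: integral_unit_fin_num => [|x]; first exact: measurable_left_massX.
by rewrite exprn_ge0 ?exprn_ile1 ?left_mass_ge0 ?left_mass_le1.
Qed.

(** Jensen's inequality, with a variance term. *)
Lemma left_mass_moment_gap m :
  ((2^-1 ^+ m.+2)%:E + (2^-1 ^+ m)%:E * \int[mu]_x ((left_mass x - 2^-1) ^+ 2)%:E
   <= \int[mu]_x (left_mass x ^+ m.+2)%:E)%E.
Proof.
set I := (\int[mu]_x (left_mass x ^+ m.+2)%:E)%E.
set W := (\int[mu]_x ((left_mass x - 2^-1) ^+ 2)%:E)%E.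
have b0 : 0 <= 2^-1 :> R by rewrite invr_ge0.
have Ifin : (I \is a fin_num)%E := left_massX_fin_num m.+2.
have Wfin : (W \is a fin_num)%E.
  apply: integral_unit_fin_num => [|x]; first exact: measurable_left_mass_var.
  rewrite sqr_ge0 /=; have := left_mass_ge0 x; have := left_mass_le1 x; nra.
have mW : measurable_fun setT (fun x => ((left_mass x - 2^-1) ^+ 2)%:E).
  by apply/measurable_EFinP; exact: measurable_left_mass_var.
have mL : measurable_fun setT (fun x => (left_mass x)%:E).
  by apply/measurable_EFinP; exact: measurable_left_mass.
have mI : measurable_fun setT (fun x => (left_mass x ^+ m.+2)%:E).
  by apply/measurable_EFinP; exact: measurable_left_massX.
pose b : R := 2^-1.
have c1 : 0 <= m.+2%:R * b ^+ m.+1 by rewrite mulr_ge0 ?exprn_ge0.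
have c2 : 0 <= b ^+ m by rewrite exprn_ge0.
have c3 : 0 <= m.+1%:R * b ^+ m.+2 by rewrite mulr_ge0 ?exprn_ge0.
have : ((m.+2%:R * b ^+ m.+1)%:E * b%:E + (b ^+ m)%:E * W
        <= I + (m.+1%:R * b ^+ m.+2)%:E)%E.
  have -> : (m.+1%:R * b ^+ m.+2)%:E = (\int[mu]_x (m.+1%:R * b ^+ m.+2)%:E)%E.
    by rewrite integral_cst //= probability_setT mule1.
  rewrite -integral_left_mass -!ge0_integralZl ?lee_fin //; last 2 first.
  - by move=> x _; rewrite lee_fin sqr_ge0.
  - by move=> x _; rewrite lee_fin left_mass_ge0.
  rewrite -!ge0_integralD //; last first.
  - exact: emeasurable_funM.
  - by move=> x _; rewrite -EFinM lee_fin mulr_ge0 // sqr_ge0.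
  - exact: emeasurable_funM.
  - by move=> x _; rewrite -EFinM lee_fin mulr_ge0 // left_mass_ge0.
  - by move=> x _; rewrite lee_fin exprn_ge0 // left_mass_ge0.
  apply: ge0_le_integral => //.
  - move=> x _; rewrite -!EFinM -EFinD lee_fin.
    by rewrite addr_ge0 // mulr_ge0 ?left_mass_ge0 ?sqr_ge0.
  - by apply: emeasurable_funD; apply: emeasurable_funM.
  - exact: emeasurable_funD.
  - move=> x _; rewrite -!EFinM -!EFinD lee_fin.
    exact: pow_tangent_gap (left_mass_ge0 x) b0.
rewrite -(fineK Ifin) -(fineK Wfin) -!EFinM -!EFinD !lee_fin -[m.+2%:R]natr1 -[m.+1%:R]natr1.
rewrite -/b ![b ^+ m.+2]exprS ![b ^+ m.+1]exprS.
have := exprn_ge0 m b0; rewrite -/b; set c := b ^+ m => c0.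
have -> : (m%:R + 1 + 1) * (b * c) * b + c * fine W =
 (m%:R + 1) * (b * (b * c)) + (b * (b * c) + c * fine W) by ring.
by rewrite [leRHS]addrC lerD2l.
Qed.

Lemma left_mass_moment_eq m :
  (\int[mu]_x (left_mass x ^+ m.+2)%:E = (2^-1 ^+ m.+2)%:E)%E <->
  {ae mu, forall x, left_mass x = 2^-1}.
Proof.
split=> [e|h]; last first.
  transitivity (\int[mu]_x (cst (2^-1 ^+ m.+2)%:E x))%E; last first.
    by rewrite integral_cst //= probability_setT mule1.
  apply: ge0_ae_eq_integral => //.
  - by apply/measurable_EFinP; exact: measurable_left_massX.
  - by move=> x _; rewrite lee_fin exprn_ge0 // left_mass_ge0.
  - by move=> x _; rewrite lee_fin exprn_ge0 // invr_ge0.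
  - by apply: filterS h => x -> _.
have W0 x : (0 <= ((left_mass x - 2^-1) ^+ 2)%:E)%E by rewrite lee_fin sqr_ge0.
have : (\int[mu]_x ((left_mass x - 2^-1) ^+ 2)%:E = 0)%E.
  have := left_mass_moment_gap m; rewrite e -leeBrDl // subee //.
  rewrite pmule_rle0 ?lte_fin ?exprn_gt0 ?invr_gt0 // => W_le0.
  by apply/eqP; rewrite eq_le W_le0 integral_ge0.
under eq_integral do rewrite -[X in X%:E]ger0_norm ?sqr_ge0 // -abse_EFin.
move=> /ae_eq_integral_abs; case=> //.
  by apply/measurable_EFinP; exact: measurable_left_mass_var.
move=> N N0; exists N; split; case: N0 => // ? ? sub; apply: subset_trans sub => x /=.
move=> nx h; apply: nx; have := h Logic.I => -[] /eqP.
by rewrite sqrf_eq0 subr_eq0 => /eqP.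
Qed.

End planar_law.

(** * The probability that the hull misses the origin *)

Section hull_probability.
Variables (R : realType) (mu : probability 'rV[R]_2 R).
Hypothesis mu_lines : null_lines mu.
Context d (T : measurableType d) (P : probability T R).
Variables (m : nat) (Y : 'I_m.+2 -> {RV P >-> 'rV[R]_2}).
Hypothesis iidY : iid_law mu Y.

(** The events [strict i] are disjoint, the events [weak i] cover, and both have the same
   probability because lines through the origin are null; [first i] is squeezed between
   them. *)
Let first i : set T := [set w | forall j, ccw (Y i w) (Y j w)].
Let strict i : set T := [set w | forall j, j != i -> 0 < det2 (Y i w) (Y j w)].
Let weak i : set T := [set w | forall j, j != i -> ccw (Y i w) (Y j w)].

Let measurable_first i : measurable (first i).
Proof.
rewrite (_ : first i = \bigcap_(j in setT) [set w | ccw (Y i w) (Y j w)]).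
  by apply: fin_bigcap_measurable => // j _; exact: measurable_ccw.
by apply/seteqP; split => w h j; [move=> _|]; exact: h.
Qed.

Let measurable_strict i : measurable (strict i).
Proof.
rewrite (_ : strict i =
    \bigcap_(j in [set j | j != i]) [set w | 0 < det2 (Y i w) (Y j w)]) //.
by apply: fin_bigcap_measurable => [|j _]; [exact: finite_finset|exact: measurable_det2_gt0].
Qed.

Let measurable_weak i : measurable (weak i).
Proof.
rewrite (_ : weak i =
    \bigcap_(j in [set j | j != i]) [set w | ccw (Y i w) (Y j w)]) //.
by apply: fin_bigcap_measurable => [|j _]; [exact: finite_finset|exact: measurable_ccw].
Qed.

Let moment := (\int[mu]_x (left_mass mu x ^+ m.+1)%:E)%E.

Let strict_prob i : P (strict i) = moment.
Proof.
rewrite /strict (pivot_all_others_prob i iidY (@measurable_left_pairs R)).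
by apply: eq_integral => x _; rewrite xsection_left_pairs.
Qed.

Let weak_prob i : P (weak i) = moment.
Proof.
pose S := [set p : 'rV[R]_2 * 'rV[R]_2 | ccw p.1 p.2].
have mS : measurable S.
  by apply: measurable_ccw; [exact: measurable_fst|exact: measurable_snd].
rewrite /weak (pivot_all_others_prob i iidY mS).
have mF : measurable_fun setT (fun x => fine (mu (xsection S x))).
  exact: (measurableT_comp (fine_measurable measurableT) (measurable_fun_xsection mu mS)).
apply: ge0_ae_eq_integral => //.
- by apply/measurable_EFinP; exact: measurable_funX.
- by apply/measurable_EFinP; exact: measurable_left_massX.
- by move=> x _; rewrite lee_fin exprn_ge0 ?fine_ge0.
- by move=> x _; rewrite lee_fin exprn_ge0 ?left_mass_ge0.
apply: filterS (ae_neq0 mu_lines) => x x0 _; congr (EFin (_ ^+ _)).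
have mx := measurable_xsection x mS.
have hx : half_plane x `<=` xsection S x.
  by move=> y xy; apply: (@mem_set _ S (x, y)); rewrite /S /= /ccw; move: xy => /= ->.
rewrite /left_mass; congr fine; apply/eqP; rewrite eq_le; apply/andP; split; last first.
  by apply: le_measure => //; apply/mem_set => //; exact: measurable_half_plane.
rewrite -[leRHS]adde0 -[X in (_ + X)%E](mu_lines x0).
have ml := measurable_line x; have mh := measurable_half_plane x.
apply: le_trans (measureU2 _ mh ml); apply: le_measure.
- exact/mem_set.
- by apply/mem_set; exact: measurableU.
move=> y /set_mem /= /orP[|/andP[/eqP]]; [by left|by right].
Qed.

Let strict_first i : strict i `<=` first i.
Proof.
move=> w h j; case: (eqVneq j i) => [->|/h]; last by rewrite /ccw => ->.
have /h : lift i ord0 != i by rewrite eq_sym neq_lift.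
rewrite /ccw det2xx eqxx ltxx => Yi; apply: dot2xx_gt0; apply: contraTneq Yi => ->.
by rewrite /det2 !mxE !mul0r subr0 ltxx.
Qed.

Let trivIset_strict : trivIset setT strict.
Proof.
apply/trivIsetP => i j _ _ ij; apply/seteqP; split => // w [/(_ j) hi /(_ i) hj].
have := hj ij; rewrite det2C oppr_gt0 ltNge ltW //.
by apply: hi; rewrite eq_sym.
Qed.

Let not_hullE :
  [set w | ~ convex_hull (fun i => Y i w) 0] = \bigcup_(i in setT) first i.
Proof.
apply/seteqP; split => w.
  by move=> /notin_hullP -/(_ isT) [i hi]; exists i.
by move=> [i _ hi]; apply/notin_hullP => //; exists i.
Qed.

Lemma measurable_not_hull : measurable [set w | ~ convex_hull (fun i => Y i w) 0].
Proof. by rewrite not_hullE; exact: fin_bigcup_measurable. Qed.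

(** Exactly one of the points has all the others to its left, up to a null set. *)
Lemma not_hull_prob : P [set w | ~ convex_hull (fun i => Y i w) 0] =
  (m.+2%:R%:E * \int[mu]_x (left_mass mu x ^+ m.+1)%:E)%E.
Proof.
have fin : finite_set [set: 'I_m.+2] by exact: finite_finset.
have sumE (F : 'I_m.+2 -> \bar R) : (forall i, F i = moment) ->
    (\sum_(i \in [set: 'I_m.+2]) F i = m.+2%:R%:E * moment)%E.
  move=> FE; rewrite (_ : setT = [set` enum 'I_m.+2]); last first.
    by apply/seteqP; split => // i _ /=; rewrite mem_enum.
  rewrite -fsbig_seq ?enum_uniq // big_enum /= (eq_bigr (fun=> moment)) => [|i _ //].
  rewrite /moment -(fineK (left_massX_fin_num mu m.+1)) sumEFin sumr_const card_ord.
  by rewrite -EFinM mulr_natl.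
rewrite -/moment not_hullE; apply/eqP; rewrite eq_le; apply/andP; split.
  rewrite -(sumE _ weak_prob).
  apply: content_sub_fsum => //.
    by apply: fin_bigcup_measurable => // i _; exact: measurable_first.
  by move=> w [i _ hi]; exists i => // j _; exact: hi.
rewrite -(sumE _ strict_prob) -measure_fin_bigcup //.
apply: le_measure.
- by apply/mem_set; apply: fin_bigcup_measurable => // i _; exact: measurable_strict.
- by apply/mem_set; apply: fin_bigcup_measurable => // i _; exact: measurable_first.
- by move=> w [i _ hi]; exists i => //; exact: strict_first.
Qed.

End hull_probability.

(** * Rigidity: laws whose left masses are almost surely one half *)

Section sphere_proj.
Variable R : realType.

Lemma measurable_invr : measurable_fun setT (@GRing.inv R).
Proof.
have -> : setT = [set 0] `|` ~` [set (0 : R)] by rewrite setUCr.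
have m0 : measurable [set (0 : R)] by exact: measurable_set1.
apply/measurable_funU => //; first exact: measurableC.
split; first exact: measurable_fun_set1.
apply: open_continuous_measurable_fun; first by apply: closed_openC; exact: closed_eq.
by move=> x /set_mem /= /eqP x0; exact: inv_continuous.
Qed.

Lemma measurable_sphere_proj k : measurable_fun setT (@sphere_proj R k).
Proof.
apply/measurable_fun_coordP => i; under eq_fun do rewrite mxE.
apply: measurable_funM; last exact: measurable_coord.
apply: (measurableT_comp measurable_invr); rewrite /norm2.
apply: measurableT_comp.
  by apply: continuous_measurable_fun; exact: sqrt_continuous.
apply: measurable_sum => j; apply: measurable_funX; exact: measurable_coord.
Qed.

Lemma norm2Z k a (x : 'rV[R]_k) : norm2 (a *: x) = `|a| * norm2 x.
Proof.
rewrite /norm2 -sqrtr_sqr -sqrtrM ?sqr_ge0 // mulr_sumr; congr Num.sqrt.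
by apply: eq_bigr => i _; rewrite mxE exprMn.
Qed.

Lemma sphere_projZ k a (x : 'rV[R]_k) : 0 < a -> sphere_proj (a *: x) = sphere_proj x.
Proof.
move=> a0; rewrite /sphere_proj norm2Z gtr0_norm // scalerA invfM mulrAC mulVf ?mul1r //.
by rewrite gt_eqF.
Qed.

Lemma sphere_projN k (x : 'rV[R]_k) : sphere_proj (- x) = - sphere_proj x.
Proof. by rewrite /sphere_proj -scaleN1r norm2Z normrN1 mul1r scalerA mulrN1 scaleNr. Qed.

Lemma norm2_eq0 k (x : 'rV[R]_k) : (norm2 x == 0) = (x == 0).
Proof.
rewrite /norm2 sqrtr_eq0 le_eqVlt ltNge sumr_ge0 /= ?orbF => [|i _]; last exact: sqr_ge0.
apply/eqP/eqP => [|->]; last by apply: big1 => i _; rewrite mxE expr0n.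
move/eqP; rewrite psumr_eq0 => [/allP h|i _]; last exact: sqr_ge0.
apply/rowP => i; apply/eqP; rewrite mxE -sqrf_eq0.
by apply: (implyP (h i _)); rewrite ?mem_index_enum.
Qed.

Lemma sphere_proj_pos k (x : 'rV[R]_k) : x != 0 -> 0 < (norm2 x)^-1.
Proof. by rewrite -norm2_eq0 invr_gt0 lt_def sqrtr_ge0 andbT. Qed.

End sphere_proj.

Section rigidity.
Variables (R : realType) (mu : probability 'rV[R]_2 R).
Hypothesis mu_lines : null_lines mu.
Local Notation V := 'rV[R]_2.
Implicit Types (x y : V) (s : R).
Hint Resolve measurable_half_plane measurable_line : core.

(** The direction of the line on which [cotan x] equals [s]. *)
Definition tilt x s : V :=
  \row_(j < 2) if j == ord0 then x ord0 ord_max - s * x ord0 ord0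
               else - x ord0 ord0 - s * x ord0 ord_max.

Lemma det2_tilt x s y : det2 (tilt x s) y = dot2 x y - s * det2 x y.
Proof. by rewrite /det2 /dot2 !mxE /=; ring. Qed.

Lemma tilt_neq0 x s : x != 0 -> tilt x s != 0.
Proof.
move=> /dot2xx_gt0 x0; apply: contraTneq x0 => /rowP h.
have h0 := h ord0; have h1 := h ord_max; rewrite !mxE /= in h0 h1.
have -> : dot2 x x = - (x ord0 ord0 * (- x ord0 ord0 - s * x ord0 ord_max)) +
   x ord0 ord_max * (x ord0 ord_max - s * x ord0 ord0) by rewrite /dot2; ring.
by rewrite h0 h1 !mulr0 oppr0 addr0 ltxx.
Qed.

(** On the half-plane to the left of [x], a decreasing function of the angle from [x]. *)
Definition cotan x y := dot2 x y / det2 x y.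

Lemma half_plane_cotan x y s : half_plane x y ->
  half_plane (- tilt x s) y <-> cotan x y < s.
Proof.
by rewrite /half_plane /= => xy; rewrite det2N det2_tilt oppr_gt0 subr_lt0 ltr_pdivrMr.
Qed.

Lemma opp_half_plane_cotan x y s : half_plane (- x) y ->
  half_plane (tilt x s) y <-> cotan x y < s.
Proof.
rewrite /half_plane /= det2N oppr_gt0 => xy.
by rewrite det2_tilt subr_gt0 ltr_ndivrMr.
Qed.

Lemma line_cotan x y s : half_plane x y -> cotan x y = s -> det2 (tilt x s) y = 0.
Proof.
rewrite /half_plane /= => xy <-; rewrite det2_tilt /cotan divfK ?subrr //.
by rewrite gt_eqF.
Qed.

Lemma cotan_half_plane x y z : half_plane x y -> half_plane x z ->
  cotan x z < cotan x y -> half_plane y z.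
Proof.
rewrite /half_plane /cotan /= => xy xz.
rewrite ltr_pdivrMr // mulrAC ltr_pdivlMr // -subr_gt0.
have -> : dot2 x y * det2 x z - dot2 x z * det2 x y = dot2 x x * det2 y z.
  by rewrite /dot2 /det2; ring.
rewrite pmulr_rgt0 //; apply: dot2xx_gt0; apply: contraTneq xy => ->.
by rewrite /det2 !mxE !mul0r subr0 ltxx.
Qed.

Lemma nondecreasing_bigcup_le d (T : measurableType d) (m : {measure set T -> \bar R})
    (F : (set T)^nat) (c : \bar R) :
  (forall n, measurable (F n)) -> nondecreasing_seq F ->
  (forall n, m (F n) <= c)%E -> (m (\bigcup_n F n) <= c)%E.
Proof.
move=> mF ndF Fc.
have cF := nondecreasing_cvg_mu (mu := m) mF (bigcup_measurable (fun k _ => mF k)) ndF.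
rewrite -(cvg_lim _ cF) //; apply: lime_le; first by apply/cvg_ex; eexists; exact: cF.
by apply: nearW.
Qed.

(** For [y] to the left of [x], the part of [half_plane x] beyond [y] is contained in
    [half_plane y], hence has mass at most one half for almost every such [y]. The set [S] of
    the thresholds [s] for which the sector [B s] at the far end of [half_plane x] has mass at
    most one half is an initial segment; it contains the cotangent of almost every [y], so
    the half-plane is exhausted, up to a null set, by an increasing sequence of sectors of
    mass at most one half. *)
Lemma ae_left_mass_le x : x != 0 -> {ae mu, forall y, left_mass mu y = 2^-1} ->
  left_mass mu x <= 2^-1.
Proof.
move=> x0 [N [mN N0 subN]].
pose B s := half_plane x `&` half_plane (- tilt x s).
have mB s : measurable (B s) by exact: measurableI.
have BP s y : half_plane x y -> (B s y <-> cotan x y < s).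
  by move=> xy; rewrite -half_plane_cotan //; split => [[]|].
pose S := [set s | (mu (B s) <= (2^-1)%:E)%E].
have Bmono s t : s <= t -> B s `<=` B t.
  by move=> st y [xy ys]; apply/(BP _ _ xy); apply: lt_le_trans st; exact/(half_plane_cotan _ xy).
have Sdown s t : s <= t -> S t -> S s.
  move=> st; apply: le_trans; apply: le_measure; [exact/mem_set|exact/mem_set|].
  exact: Bmono.
have Sae y : half_plane x y -> ~ N y -> S (cotan x y).
  move=> xy Ny; have yE : left_mass mu y = 2^-1 by apply: contrapT => h; exact/Ny/subN.
  rewrite /S /= -yE -left_massE; apply: le_measure.
  - exact/mem_set.
  - by apply/mem_set; exact: measurable_half_plane.
  - by move=> z [xz ?]; apply: (cotan_half_plane xy xz); exact/(half_plane_cotan _ xz).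
(* [L] receives the points whose cotangent is the supremum of [S], if there is one. *)
have conclude (F : (set V)^nat) (L : set V) : (forall n, measurable (F n)) ->
    (forall n, mu (F n) <= (2^-1)%:E)%E ->
    nondecreasing_seq F -> measurable L -> mu L = 0%E ->
    (forall y, half_plane x y -> S (cotan x y) -> (\bigcup_n F n `|` L) y) ->
    left_mass mu x <= 2^-1.
  move=> mF F_le ndF mL L0 cov.
  have mUF : measurable (\bigcup_n F n) by exact: bigcup_measurable.
  rewrite -lee_fin -left_massE.
  apply: (@le_trans _ _ (mu (N `|` (\bigcup_n F n `|` L)))).
    apply: le_measure.
    - by apply/mem_set; exact: measurable_half_plane.
    - by apply/mem_set; apply: measurableU => //; exact: measurableU.
    - by move=> y xy; have [|Ny] := pselect (N y); [left|right; apply: cov => //; exact: Sae].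
  apply: le_trans (measureU2 _ mN _) _; first exact: measurableU.
  rewrite [X in (X + _)%E]N0 add0e; apply: le_trans (measureU2 _ mUF mL) _.
  rewrite [X in (_ + X)%E]L0 adde0; exact: nondecreasing_bigcup_le.
have [[s0 Ss0]|S0] := pselect (S !=set0); last first.
  apply: (conclude (fun=> set0) set0) => //.
  - by move=> _; rewrite measure0 lee_fin invr_ge0.
  - by move=> y _ Sy; case: S0; exists (cotan x y).
have [Sub|Sub] := pselect (has_ubound S).
  pose T := sup S.
  have T_lt s : s < T -> S s.
    move=> /sup_gt -/(_ (ex_intro _ s0 Ss0)) [t St st]; exact: Sdown (ltW st) St.
  apply: (conclude (fun n => B (T - n.+1%:R^-1)) [set y | det2 (tilt x T) y = 0]) => //.
  - by move=> n; apply: T_lt; rewrite ltrBlDr ltrDl invr_gt0.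
  - move=> n m nm; apply/subsetPset; apply: Bmono.
    by rewrite lerD2l lerN2 lef_pV2 ?posrE // ler_nat.
  - by apply: mu_lines; exact: tilt_neq0.
  - move=> y xy Sy; have : cotan x y <= T by exact: ub_le_sup.
    rewrite le_eqVlt => /orP[/eqP yT|]; first by right; exact: line_cotan.
    rewrite -subr_gt0 => yT; left.
    have [n yn] := ltr_add_invr yT; exists n => //; apply/(BP _ _ xy).
    by rewrite add0r in yn; rewrite ltrBrDl -ltrBrDr.
apply: (conclude (fun n => B n%:R) set0) => //.
- move=> n; have [t St nt] : exists2 t, S t & n%:R <= t.
    apply: contrapT => h; apply: Sub; exists n%:R => t St.
    by rewrite leNgt; apply/negP => nt; apply: h; exists t => //; exact: ltW.
  exact: Sdown nt St.
- by move=> n m nm; apply/subsetPset; apply: Bmono; rewrite ler_nat.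
- move=> y xy _; left; exists (Num.truncn (cotan x y)).+1 => //; apply/(BP _ _ xy).
  exact: truncnS_gt.
Qed.

Lemma ae_left_mass_half : {ae mu, forall y, left_mass mu y = 2^-1} ->
  forall x, x != 0 -> left_mass mu x = 2^-1.
Proof.
move=> h x x0; have xN0 : - x != 0 by rewrite oppr_eq0.
have := left_massN mu_lines x0.
have := ae_left_mass_le x0 h; have := ae_left_mass_le xN0 h; lra.
Qed.

Lemma half_plane_partition x (S : set V) : x != 0 -> measurable S ->
  mu S = (mu (S `&` half_plane x) + mu (S `&` half_plane (- x)))%E.
Proof.
move=> x0 mS.
have mI z : measurable (S `&` half_plane z).
  by apply: measurableI => //; exact: measurable_half_plane.
have mU : measurable ((S `&` half_plane x) `|` (S `&` half_plane (- x))).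
  exact: measurableU.
have ml := measurable_line x.
rewrite -measureU //; last first.
  apply/seteqP; split => // z [[_ +] [_]]; rewrite /half_plane /= det2N oppr_gt0.
  by move=> h1 h2; have := lt_trans h1 h2; rewrite ltxx.
apply/eqP; rewrite eq_le; apply/andP; split; last first.
  by apply: le_measure; [exact/mem_set|exact/mem_set|by move=> z [[]|[]]].
rewrite -[leRHS]adde0 -[X in (_ + X)%E](mu_lines x0).
apply: le_trans (measureU2 _ mU ml); apply: le_measure.
- exact/mem_set.
- by apply/mem_set; exact: measurableU.
move=> z Sz; case: (ltgtP (det2 x z) 0) => h; [left; right|left; left|by right];
  by split => //; rewrite /half_plane /= ?det2N ?oppr_gt0.
Qed.

(** From here on the upper and lower half-planes are both described by the cotangent of the
   angle; the unit vectors of cotangent [s] are [dir s] and [- dir s]. *)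
Let e : V := \row_(j < 2) (j == ord0)%:R.

Let e_neq0 : e != 0.
Proof. by apply/eqP => /rowP /(_ ord0) /eqP; rewrite !mxE oner_eq0. Qed.

Let det2e y : det2 e y = y ord0 ord_max.
Proof. by rewrite /det2 !mxE /= mul1r mul0r subr0. Qed.

Let cotane y : cotan e y = y ord0 ord0 / y ord0 ord_max.
Proof. by rewrite /cotan det2e /dot2 !mxE /= mul1r mul0r addr0. Qed.

Let measurable_cotan : measurable_fun setT (cotan e).
Proof.
rewrite (_ : cotan e = fun y => y ord0 ord0 / y ord0 ord_max); last exact/funext/cotane.
apply: measurable_funM; first exact: measurable_coord.
by apply: (measurableT_comp (@measurable_invr R)); exact: measurable_coord.
Qed.

Let dir (s : R) : V := sphere_proj (\row_(j < 2) if j == ord0 then s else 1).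

Let measurable_dir : measurable_fun setT dir.
Proof.
apply: (measurableT_comp (@measurable_sphere_proj R 2)).
apply/measurable_fun_coordP => j; under eq_fun do rewrite mxE.
by case: (j == ord0); [exact: measurable_id|exact: measurable_cst].
Qed.

Let sphere_proj_upper y : half_plane e y -> sphere_proj y = dir (cotan e y).
Proof.
rewrite /half_plane /= det2e => y0; rewrite /dir -[RHS](sphere_projZ _ y0).
congr sphere_proj; apply: rV2P; rewrite !mxE /= ?mulr1 // cotane mulrC divfK //.
by rewrite gt_eqF.
Qed.

Let sphere_proj_lower y : half_plane (- e) y -> sphere_proj y = - dir (cotan e y).
Proof.
rewrite /half_plane /= det2N => y0; rewrite -[y in LHS]opprK sphere_projN; congr (- _).
have -> : cotan e y = cotan e (- y) by rewrite !cotane !mxE invrN mulrNN.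
by apply: sphere_proj_upper; rewrite /half_plane /= det2e mxE -det2e.
Qed.

Let cotan_law (x : V) : {measure set R -> \bar R} :=
  measure_function_pushforward__canonical__measure_function_Measure
    (mrestr mu (measurable_half_plane x)) measurable_cotan.

Let cotan_lawE x A : cotan_law x A = mu (cotan e @^-1` A `&` half_plane x).
Proof. by []. Qed.

Section symmetric.
Hypothesis mu_half : forall x, x != 0 -> left_mass mu x = 2^-1.

(** The sectors of cotangent less than [s] above and below the axis are opposite; both
   complete the same third sector to a half-plane of mass one half. *)
Let cotan_law_ray s : cotan_law e `]-oo, s[%classic = cotan_law (- e) `]-oo, s[%classic.
Proof.
have w0 := tilt_neq0 s e_neq0; set w := tilt e s in w0.
have -> : cotan_law e `]-oo, s[%classic = mu (half_plane e `&` half_plane (- w)).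
  rewrite cotan_lawE; congr (mu _); apply/seteqP; split => y /=.
    by rewrite in_itv /= => -[ys ey]; split => //; exact/(half_plane_cotan _ ey).
  by move=> [ey ys]; rewrite in_itv /=; split => //; exact/(half_plane_cotan _ ey).
have -> : cotan_law (- e) `]-oo, s[%classic = mu (half_plane w `&` half_plane (- e)).
  rewrite cotan_lawE; congr (mu _); apply/seteqP; split => y /=.
    by rewrite in_itv /= => -[ys ey]; split => //; exact/(opp_half_plane_cotan _ ey).
  by move=> [ys ey]; rewrite in_itv /=; split => //; exact/(opp_half_plane_cotan _ ey).
have hw := half_plane_partition e_neq0 (measurable_half_plane w).
have he := half_plane_partition w0 (measurable_half_plane e).
rewrite setIC left_massE mu_half // in he; rewrite left_massE mu_half // in hw.
have fin : mu (half_plane w `&` half_plane e) \is a fin_num.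
  by apply: fin_num_measure; apply: measurableI; exact: measurable_half_plane.
rewrite -[LHS](addeK _ fin) -[RHS](addeK _ fin); congr (_ - _)%E.
by rewrite [LHS]addeC [RHS]addeC -he -hw.
Qed.

Let cotan_law_sym A : measurable A -> cotan_law e A = cotan_law (- e) A.
Proof.
apply: (measure_unique (@RGenInftyO.G R) (fun n => `]-oo, n%:R[%classic)).
- exact: RGenInftyO.measurableE.
- move=> _ _ [s ->] [t ->]; exists (Num.min s t).
  by apply/seteqP; split => r /=; rewrite !in_itv /= lt_min => /andP.
- by move=> n; exists n%:R.
- apply/seteqP; split => // r _; exists (Num.truncn r).+1 => //=.
  by rewrite in_itv /= truncnS_gt.
- by move=> _ [s ->]; exact: cotan_law_ray.
- move=> n; rewrite cotan_lawE; apply: le_lt_trans (ltry 1); apply: probability_le1.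
  apply: measurableI; last exact: measurable_half_plane.
  by rewrite -[X in measurable X]setTI; exact: measurable_cotan.
Qed.

Let sphere_proj_law A : measurable A ->
  mu [set y | A (sphere_proj y)] =
  (cotan_law e (dir @^-1` A) + cotan_law (- e) [set s | A (- dir s)%R])%E.
Proof.
move=> mA; rewrite (half_plane_partition e_neq0); last first.
  by rewrite -[X in measurable X]setTI; exact: measurable_sphere_proj.
rewrite !cotan_lawE; congr (mu _ + mu _)%E.
  by apply/seteqP; split => y /= -[Ay ey]; split => //;
    move: Ay; rewrite sphere_proj_upper.
by apply/seteqP; split => y /= -[Ay ey]; split => //;
  move: Ay; rewrite sphere_proj_lower.
Qed.

Lemma sphere_proj_symmetric A : measurable A ->
  mu [set y | A (sphere_proj y)] = mu [set y | A (- sphere_proj y)].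
Proof.
move=> mA.
have mdir (B : set V) : measurable B -> measurable (dir @^-1` B).
  by move=> mB; rewrite -[X in measurable X]setTI; exact: measurable_dir.
have mNA : measurable [set y : V | A (- y)].
  by rewrite -[X in measurable X]setTI; exact: measurable_opp_rV.
rewrite (sphere_proj_law mA) -[RHS]/(mu [set y | [set z | A (- z)] (sphere_proj y)]).
rewrite (sphere_proj_law mNA) addeC; congr (_ + _)%E.
  by apply/esym; apply: cotan_law_sym; exact: mdir mNA.
rewrite cotan_law_sym; last exact: mdir.
by congr (cotan_law _ _); apply/seteqP; split => s /=; rewrite opprK.
Qed.
End symmetric.

End rigidity.

Section symmetric_half_planes.
Variables (R : realType) (mu : probability 'rV[R]_2 R).
Hypothesis mu_lines : null_lines mu.

Lemma symmetric_left_mass :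
  (forall A, measurable A ->
     mu [set y | A (sphere_proj y)] = mu [set y | A (- sphere_proj y)]) ->
  forall x, x != 0 -> left_mass mu x = 2^-1.
Proof.
move=> sym x x0; have := left_massN mu_lines x0.
suff -> : left_mass mu (- x) = left_mass mu x by lra.
have projE y z : 0 < det2 z (sphere_proj y) <-> 0 < det2 z y.
  rewrite /sphere_proj det2Zr; have [->|y0] := eqVneq y 0.
    by rewrite /det2 !mxE !mulr0 subr0 mulr0.
  by rewrite pmulr_rgt0 // sphere_proj_pos.
have detNr y z : det2 z (- y) = det2 (- z) y by rewrite /det2 !mxE; ring.
have := sym _ (measurable_half_plane x).
rewrite (_ : [set y | _ (sphere_proj y)] = half_plane x); last first.
  by apply/seteqP; split => y /projE.
rewrite (_ : [set y | _ (- sphere_proj y)] = half_plane (- x)).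
  by rewrite !left_massE => -[].
by apply/seteqP; split => y; rewrite /half_plane /= detNr => /projE.
Qed.

End symmetric_half_planes.

(** * Laws with a density, and the uniform law on the circle *)

Section densities.
Variable R : realType.

Lemma continuous_null k d (T : measurableType d) (P : probability T R)
    (X : {RV P >-> 'rV[R]_k}) A : continuous_random_vector P X ->
  measurable A -> lebesgue_rV R k A = 0%E -> distribution P X A = 0%E.
Proof.
move=> [f [mf f0 fE]] mA A0; rewrite fE //; apply: null_set_integral => //.
by apply/measurable_EFinP; exact: measurable_funTS.
Qed.

Lemma lebesgue_rV1_set1 (c : R) : lebesgue_rV R 1 [set v | v ord0 ord0 = c] = 0%E.
Proof.
rewrite [X in lebesgue_rV R 1 X](_ : _ = [set v : 'rV[R]_1 | forall i, [set c] (v ord0 i)]).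
  rewrite (lebesgue_rV_box (A := fun=> [set c])) // big_ord_recl big_ord0 mule1.
  exact: lebesgue_measure_set1.
apply/seteqP; split => v /= h; [move=> i|exact: (h ord0)].
by case: (unliftP ord0 i) => [[]|->].
Qed.

Lemma lebesgue_line x : x != 0 ->
  lebesgue_rV R 2 [set y | det2 x y = 0] = 0%E.
Proof.
move=> x0; have [x00|x00] := eqVneq (x ord0 ord0) 0.
  have x1 : x ord0 ord_max != 0.
    by apply: contra x0 => /eqP x1; apply/eqP/rV2P; rewrite mxE.
  pose A (i : 'I_2) : set R := if i == ord0 then [set 0] else setT.
  rewrite [X in lebesgue_rV R 2 X](_ : _ = [set v : 'rV[R]_2 | forall i, A i (v ord0 i)]).
    rewrite (lebesgue_rV_box (A := A)) => [|i]; last by rewrite /A; case: ifP.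
    by rewrite big_ord_recl {1}/A eqxx [X in (X * _)%E]lebesgue_measure_set1 mul0e.
  apply/seteqP; split => y /=; rewrite /det2 x00 mul0r sub0r.
    move=> /eqP; rewrite oppr_eq0 mulf_eq0 (negPf x1) /= => /eqP y0 i.
    by rewrite /A; case: eqP => // ->.
  by move=> /(_ ord0); rewrite /A eqxx /= => ->; rewrite mulr0 oppr0.
rewrite /= /lebesgueS /pushforward /product_measure1.
apply: integral0_eq => a _ /=.
rewrite -[LHS]/(lebesgue_rV R 1 (xsection (@cons_rV R 1 @^-1` [set y | det2 x y = 0]) a)).
rewrite -[RHS](lebesgue_rV1_set1 (x ord0 ord_max * a / x ord0 ord0)); congr (lebesgue_rV R 1 _).
have E (v : 'rV[R]_1) : cons_rV (a, v) ord0 ord_max = v ord0 ord0 :> R.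
  by rewrite (_ : ord_max = lift ord0 ord0 :> 'I_2) ?cons_rVS //; exact: val_inj.
apply/seteqP; split => v /=.
  move=> /set_mem /= /eqP; rewrite /det2 E cons_rV0 subr_eq0 => /eqP <- /=.
  by rewrite mulrC mulKf.
move=> vE; apply/mem_set; rewrite /= /det2 E cons_rV0 vE /=.
by rewrite mulrC divfK // subrr.
Qed.

Lemma continuous_null_lines d (T : measurableType d) (P : probability T R)
    (X : {RV P >-> 'rV[R]_2}) :
  continuous_random_vector P X -> null_lines (distribution P X).
Proof.
move=> cX x x0; apply: continuous_null => //; first exact: measurable_line.
exact: lebesgue_line.
Qed.

End densities.

Section uniform_circle.
Variable R : realType.
Local Notation pi := (@trigo.pi R).
Local Notation arc := (uniform_prob (twopi_gt0 R)).

Lemma uniform_probE (a b : R) (ab : a < b) A : measurable A ->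
  uniform_prob ab A = ((b - a)^-1%:E * lebesgue_measure (A `&` `[a, b]))%E.
Proof.
move=> mA; rewrite /uniform_prob integral_uniform_pdf.
rewrite (eq_integral (fun=> (b - a)^-1%:E)) => [|x].
  by rewrite integral_cst //=; exact: measurableI.
by move=> /set_mem [_]; rewrite /= in_itv /= /uniform_pdf => ->.
Qed.

Lemma det2_circle_pt (s t : R) : det2 (circle_pt s) (circle_pt t) = sin (t - s).
Proof. by rewrite /det2 !mxE /= sinB; ring. Qed.

Lemma circle_ptDpi (t : R) : circle_pt (t + pi) = - circle_pt t.
Proof. by apply: rV2P; rewrite !mxE /= ?cosDpi ?sinDpi. Qed.

Lemma measurable_circle_pt : measurable_fun setT (@circle_pt R).
Proof.
apply/measurable_fun_coordP => j; under eq_fun do rewrite mxE.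
case: (j == ord0); apply: continuous_measurable_fun.
  exact: continuous_cos.
exact: continuous_sin.
Qed.

Lemma lebesgue_measureD (c : R) (A : set R) : measurable A ->
  lebesgue_measure [set t | A (t + c)] = lebesgue_measure A.
Proof.
move=> mA; rewrite -[LHS]/(pushforward lebesgue_measure
  ((fun t => t + c) : _ -> measurableTypeR R) A).
apply/esym/lebesgue_measure_unique => //= [|_ _ [[a b]] _ <-].
  by apply: (measurable_funD (@measurable_id _ _ _) (measurable_cst c)).
rewrite /pushforward (_ : _ @^-1` _ = `]a - c, b - c]%classic).
  rewrite !lebesgue_measure_itv /= !lte_fin ltrD2r.
  by case: ifP => // _; rewrite -!EFinD; congr EFin; ring.
by apply/seteqP; split => t /=; rewrite !in_itv /= ltrBlDr lerBrDr.
Qed.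

(** Two angles of the same line differ by a multiple of [pi], so that each half-turn
    contains at most one of them. *)
Lemma circle_lines_countable (x : 'rV[R]_2) : x != 0 ->
  countable [set t : R | det2 x (circle_pt t) = 0].
Proof.
move=> x0; apply/countable_injP; exists (fun t => pickle (Num.floor (t / pi))).
move=> s t /set_mem /= s0 /set_mem /= t0 /(pcan_inj pickleK) st.
have sin0 u v : det2 x (circle_pt u) = 0 -> det2 x (circle_pt v) = 0 -> sin (v - u) = 0.
  move=> u0 v0; rewrite -det2_circle_pt; apply/eqP.
  have := det2_cycle x (circle_pt u) (circle_pt v).
  rewrite u0 (det2C x) v0 oppr0 !scale0r !addr0 => /eqP.
  by rewrite scaler_eq0 (negPf x0) orbF.
have near u v : Num.floor (u / pi) = Num.floor (v / pi) -> u < v -> 0 < sin (v - u).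
  move=> uv ltuv; apply: sin_gt0_pi; rewrite subr_gt0 ltuv /=.
  have p0 : 0 < pi :> R := pi_gt0 R.
  have hu : (Num.floor (v / pi))%:~R * pi <= u by rewrite -ler_pdivlMr // -uv floor_le.
  have hv : v < (Num.floor (v / pi) + 1)%:~R * pi by rewrite -ltr_pdivrMr // floorD1_gt.
  by rewrite intrD mulrDl mul1r in hv; lra.
case: (ltgtP s t) => // lst.
  by have := near _ _ st lst; rewrite sin0 // ltxx.
by have := near _ _ (esym st) lst; rewrite sin0 // ltxx.
Qed.

(** A half-turn exchanges the two halves of the period. *)
Lemma lebesgue_turn (A : set R) : measurable A -> (forall t, A (t + pi + pi) = A t) ->
  lebesgue_measure ([set t | A (t + pi)] `&` `]0, 2 * pi]) =
  lebesgue_measure (A `&` `]0, 2 * pi]).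
Proof.
move=> mA perA.
have p0 : 0 < pi :> R := pi_gt0 R.
pose I1 : set R := `]0, pi]%classic; pose I2 : set R := `]pi, 2 * pi]%classic.
have split2 B : measurable B -> lebesgue_measure (B `&` `]0, 2 * pi]) =
    (lebesgue_measure (B `&` I1) + lebesgue_measure (B `&` I2))%E.
  move=> mB; rewrite -measureU; last 3 first.
  - by apply: measurableI => //; exact: measurable_itv.
  - by apply: measurableI => //; exact: measurable_itv.
  - apply/seteqP; split => // t [[_ +] [_]]; rewrite /I1 /I2 /= !in_itv /=.
    by move=> /andP[_ h] /andP[h' _]; move: (le_lt_trans h h'); rewrite ltxx.
  congr lebesgue_measure; rewrite -setIUr; congr (_ `&` _).
  apply/seteqP; split => t; rewrite /I1 /I2 /= !in_itv /=.
    by move=> /andP[t0 t2]; case: (leP t pi) => h; [left|right]; apply/andP.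
  by case=> /andP[h1 h2]; apply/andP; split => //; lra.
have mAp : measurable [set t | A (t + pi)].
  rewrite -[X in measurable X]setTI.
  by apply: (measurable_funD (@measurable_id _ _ _) (measurable_cst (pi : R))).
rewrite !split2 // addeC; congr (_ + _)%E.
  rewrite -[LHS](lebesgue_measureD pi); last first.
    by apply: measurableI => //; exact: measurable_itv.
  congr lebesgue_measure; apply/seteqP; split => t; rewrite /I1 /I2 /= !in_itv /= perA.
    by move=> [At /andP[h1 h2]]; split => //; apply/andP; split; lra.
  by move=> [At /andP[h1 h2]]; split => //; apply/andP; split; lra.
rewrite -[RHS](lebesgue_measureD pi); last first.
  by apply: measurableI => //; exact: measurable_itv.
congr lebesgue_measure; apply/seteqP; split => t; rewrite /I1 /I2 /= !in_itv /=.
  by move=> [At /andP[h1 h2]]; split => //; apply/andP; split; lra.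
by move=> [At /andP[h1 h2]]; split => //; apply/andP; split; lra.
Qed.

Lemma uniform_angle_turn (A : set R) : measurable A -> (forall t, A (t + pi + pi) = A t) ->
  arc [set t | A (t + pi)] = arc A.
Proof.
move=> mA perA.
have half_open B : measurable B ->
    lebesgue_measure (B `&` `[0, 2 * pi]) = lebesgue_measure (B `&` `]0, 2 * pi]).
  move=> mB; apply/eqP; rewrite eq_le; apply/andP; split; last first.
    apply: le_measure; [apply/mem_set; exact: measurableI|apply/mem_set; exact: measurableI|].
    by move=> t [Bt]; rewrite /= !in_itv /= => /andP[/ltW -> ->].
  rewrite -[leRHS]adde0 -[X in (_ + X)%E](lebesgue_measure_set1 (0 : R)).
  have mI : measurable (B `&` `]0, 2 * pi]) by exact: measurableI.
  have m0 : measurable [set (0 : R)] by exact: measurable_set1.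
  apply: le_trans (measureU2 lebesgue_measure mI m0); apply: le_measure.
  - by apply/mem_set; exact: measurableI.
  - by apply/mem_set; exact: measurableU.
  move=> t [Bt]; rewrite /= !in_itv /= le_eqVlt => /andP[/orP[/eqP <- _|t0 t2]].
    by right.
  by left; split => //; rewrite t0.
have mAp : measurable [set t | A (t + pi)].
  rewrite -[X in measurable X]setTI.
  by apply: (measurable_funD (@measurable_id _ _ _) (measurable_cst (pi : R))).
rewrite !uniform_probE // !half_open //; congr (_ * _)%E.
exact: lebesgue_turn.
Qed.

Section law.
Variable mu : probability 'rV[R]_2 R.
Hypothesis mu_circle : forall A, measurable A -> mu A = @sphere_law R 2 A.

Let circleE A : measurable A -> mu A = arc (@circle_pt R @^-1` A).
Proof. by move=> /mu_circle. Qed.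

Let mcircle A : measurable A -> measurable (@circle_pt R @^-1` A).
Proof. by move=> mA; rewrite -[X in measurable X]setTI; exact: measurable_circle_pt. Qed.

Lemma uniform_null_lines : null_lines mu.
Proof.
move=> x x0; have ml := measurable_line x; rewrite circleE //.
have mp := mcircle ml; rewrite uniform_probE //.
rewrite [X in (_ * X)%E](_ : _ = 0%E) ?mule0 //; apply/eqP.
rewrite -measure_le0 -[leRHS](countable_lebesgue_measure0 (circle_lines_countable x0)).
by apply: le_measure; [apply/mem_set; exact: measurableI|exact/mem_set|exact: subIsetl].
Qed.

Lemma uniform_left_mass x : x != 0 -> left_mass mu x = 2^-1.
Proof.
move=> x0; have := left_massN uniform_null_lines x0.
suff -> : left_mass mu (- x) = left_mass mu x by lra.
have mx := measurable_half_plane x.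
apply: EFin_inj; rewrite -!left_massE !circleE //; last exact: measurable_half_plane.
have detN t : det2 x (- circle_pt t) = - det2 x (circle_pt t).
  by rewrite /det2 !mxE; ring.
rewrite -(uniform_angle_turn (mcircle mx)) => [|t]; last first.
  by rewrite /= !circle_ptDpi opprK.
congr (arc _); apply/seteqP; split => t; rewrite /half_plane /= circle_ptDpi detN det2N //.
Qed.

End law.

End uniform_circle.

(** * The one-dimensional case *)

Section line_law.
Variable R : realType.
Local Notation V := 'rV[R]_1.

Definition pos : set V := [set v | 0 < v ord0 ord0].
Definition neg : set V := [set v | v ord0 ord0 < 0].

Lemma measurable_pos : measurable pos.
Proof.
by apply: measurable_bool_set; apply: measurable_fun_ltr => //; exact: measurable_coord.
Qed.

Lemma measurable_neg : measurable neg.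
Proof.
by apply: measurable_bool_set; apply: measurable_fun_ltr => //; exact: measurable_coord.
Qed.

Lemma measurable_zero : measurable [set v : V | v ord0 ord0 = 0].
Proof.
have mp := measurable_pos; have mn := measurable_neg.
rewrite (_ : [set _ | _] = ~` (pos `|` neg)).
  by apply: measurableC; exact: measurableU.
apply/seteqP; split => v /=.
  by rewrite /pos /neg /= => ->; rewrite ltxx => -[].
by move=> /not_orP[/negP + /negP]; rewrite -!leNgt => v1 v2; apply/eqP; rewrite eq_le v1.
Qed.

Lemma rV1P (u v : V) : u ord0 ord0 = v ord0 ord0 -> u = v.
Proof. by move=> uv; apply/rowP => i; case: (unliftP ord0 i) => [[]|->]. Qed.

Lemma same_sign_notin_hull n (x : 'I_n -> V) (s : R) :
  (forall i, 0 < s * x i ord0 ord0) -> ~ convex_hull x 0.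
Proof.
move=> x0 [a [a0 a1 e]].
have : \sum_i a i * (s * x i ord0 ord0) == 0.
  have /rowP/(_ ord0) := e; rewrite mxE summxE => /(congr1 ( *%R s)).
  rewrite mulr0 mulr_sumr => s0; rewrite [X in _ == X]s0; apply/eqP.
  by apply: eq_bigr => i _; rewrite mxE; ring.
rewrite psumr_eq0 => [/allP h|i _]; last by rewrite mulr_ge0 // ltW.
move/eqP: a1; rewrite big1 ?(eq_sym 0) ?oner_eq0 // => i _.
have := h i; rewrite mem_index_enum => /(_ isT).
by rewrite mulf_eq0 (gt_eqF (x0 i)) orbF => /eqP.
Qed.

Lemma notin_hull1P n (x : 'I_n -> V) :
  ~ convex_hull x 0 <-> (forall i, pos (x i)) \/ (forall i, neg (x i)).
Proof.
split=> [h|[h|h]]; last 2 first.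
- by apply: (@same_sign_notin_hull _ _ 1) => i; rewrite mul1r; exact: h.
- by apply: (@same_sign_notin_hull _ _ (-1)) => i; rewrite mulN1r oppr_gt0; exact: h.
apply: contrapT => /not_orP[/existsNP[i /negP xi] /existsNP[j /negP xj]].
rewrite -leNgt in xi; rewrite -leNgt in xj; apply: h.
have [xij|xij] := eqVneq (x i ord0 ord0) (x j ord0 ord0).
  apply: (@convex_hull_comb3 _ _ _ x i i i 1 0 0); rewrite ?addr0 ?ltr01 //.
  have x0 : x i ord0 ord0 = 0 by apply/eqP; rewrite eq_le xi xij xj.
  by apply: rV1P; rewrite !mxE x0; ring.
apply: (@convex_hull_comb3 _ _ _ x i j j (x j ord0 ord0) (- x i ord0 ord0) 0).
- by [].
- by rewrite oppr_ge0.
- by [].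
- by rewrite addr0 subr_gt0 lt_def eq_sym xij (le_trans xi xj).
- by apply: rV1P; rewrite !mxE; ring.
Qed.

Lemma sphere_proj_pos1 v : pos v -> sphere_proj v = const_mx 1.
Proof.
move=> v0; rewrite -(sphere_projZ v (a := (v ord0 ord0)^-1)) ?invr_gt0 //.
rewrite (_ : _ *: _ = const_mx 1).
  rewrite /sphere_proj (_ : norm2 _ = 1) ?invr1 ?scale1r //.
  by rewrite /norm2 big_ord_recl big_ord0 mxE expr1n addr0 sqrtr1.
by apply: rV1P; rewrite !mxE mulVf // gt_eqF.
Qed.

Lemma sphere_proj_neg1 v : neg v -> sphere_proj v = const_mx (-1).
Proof.
move=> v0; rewrite -[v]opprK sphere_projN sphere_proj_pos1.
  by apply/rowP => l; rewrite !mxE.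
by rewrite /pos /= mxE oppr_gt0.
Qed.

Variable mu : probability V R.
Hypothesis mu0 : mu [set v | v ord0 ord0 = 0] = 0%E.

Lemma line_split S : measurable S -> mu S = (mu (S `&` pos) + mu (S `&` neg))%E.
Proof.
move=> mS; have mp := measurable_pos; have mn := measurable_neg.
have mSp : measurable (S `&` pos) by exact: measurableI.
have mSn : measurable (S `&` neg) by exact: measurableI.
have mU : measurable ((S `&` pos) `|` (S `&` neg)) by exact: measurableU.
have m0 := measurable_zero.
rewrite -measureU //; last first.
  apply/seteqP; split => // v [[_ p] [_ q]].
  by have := lt_trans p q; rewrite ltxx.
apply/eqP; rewrite eq_le; apply/andP; split; last first.
  by apply: le_measure; [exact/mem_set|exact/mem_set|by move=> z [[]|[]]].
rewrite -[leRHS]adde0 -[X in (_ + X)%E]mu0.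
apply: le_trans (measureU2 _ mU m0); apply: le_measure.
- exact/mem_set.
- by apply/mem_set; exact: measurableU.
by move=> z Sz; case: (ltgtP (z ord0 ord0) 0) => h; [left; right|left; left|right].
Qed.

Definition pos_mass : R := fine (mu pos).

Lemma pos_massE : mu pos = pos_mass%:E.
Proof. by rewrite fineK // fin_num_measure //; exact: measurable_pos. Qed.

Lemma neg_massE : mu neg = (1 - pos_mass)%:E.
Proof.
have := line_split measurableT; rewrite !setTI pos_massE.
rewrite probability_setT -(fineK (fin_num_measure mu _ measurable_neg)) -EFinD.
by move=> -[->]; rewrite addrC addKr.
Qed.

Lemma pos_mass01 : 0 <= pos_mass <= 1.
Proof.
by rewrite fine_ge0 //= -lee_fin -pos_massE probability_le1 //; exact: measurable_pos.
Qed.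

(** The projection takes only the values [1] and [-1], almost surely. *)
Lemma symmetric_line : (forall A, measurable A ->
    mu [set y | A (sphere_proj y)] = mu [set y | A (- sphere_proj y)]) <->
  pos_mass = 2^-1.
Proof.
split=> [sym|p2 A mA].
  have := sym _ measurable_pos.
  have sgn y : ((0 < sphere_proj y ord0 ord0) = (0 < y ord0 ord0)) *
               ((sphere_proj y ord0 ord0 < 0) = (y ord0 ord0 < 0)).
    have [->|y0] := eqVneq y 0; first by rewrite /sphere_proj scaler0.
    by rewrite mxE pmulr_rgt0 ?pmulr_rlt0 // sphere_proj_pos.
  rewrite (_ : [set y | pos (sphere_proj y)] = pos); last first.
    by apply/seteqP; split => y; rewrite /pos /= sgn.
  rewrite (_ : [set y | pos (- sphere_proj y)] = neg); last first.
    by apply/seteqP; split => y; rewrite /pos /neg /= mxE oppr_gt0 sgn.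
  rewrite pos_massE neg_massE => -[]; lra.
have mP B : measurable B -> measurable [set y : V | B (sphere_proj y)].
  by move=> mB; rewrite -[X in measurable X]setTI; exact: measurable_sphere_proj.
have mNA : measurable [set y : V | A (- y)].
  by rewrite -[X in measurable X]setTI; exact: measurable_opp_rV.
have halves (c : Prop) : mu [set y | c /\ pos y] = mu [set y | c /\ neg y].
  have [hc|hc] := pselect c; last first.
    by congr (mu _); apply/seteqP; split => y [].
  have -> : [set y | c /\ pos y] = pos by apply/seteqP; split => y // [].
  have -> : [set y | c /\ neg y] = neg by apply/seteqP; split => y // [].
  by rewrite pos_massE neg_massE p2; congr EFin; lra.
rewrite (line_split (mP _ mA)) (line_split (mP _ mNA)) addeC.
have -> : [set y | A (sphere_proj y)] `&` neg = [set y | A (const_mx (-1)) /\ neg y].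
  by apply/seteqP; split => y [] /= + yn; rewrite sphere_proj_neg1.
have -> : [set y | A (sphere_proj y)] `&` pos = [set y | A (const_mx 1) /\ pos y].
  by apply/seteqP; split => y [] /= + yn; rewrite sphere_proj_pos1.
rewrite halves -halves; congr (mu _ + mu _)%E.
  apply/seteqP; split => y [] /= + yn; rewrite sphere_proj_pos1 //.
    by rewrite (_ : - const_mx 1 = const_mx (-1)) //; apply: rV1P; rewrite !mxE.
  by rewrite (_ : - const_mx 1 = const_mx (-1)) //; apply: rV1P; rewrite !mxE.
apply/seteqP; split => y [] /= + yn; rewrite sphere_proj_neg1 //.
  by rewrite (_ : - const_mx (-1) = const_mx 1) //; apply: rV1P; rewrite !mxE opprK.
by rewrite (_ : - const_mx (-1) = const_mx 1) //; apply: rV1P; rewrite !mxE opprK.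
Qed.

Context d (T : measurableType d) (P : probability T R).
Variables (m : nat) (Y : 'I_m.+2 -> {RV P >-> V}).
Hypothesis iidY : iid_law mu Y.

Let not_hull1E : [set w | ~ convex_hull (fun i => Y i w) 0] =
  [set w | forall i, pos (Y i w)] `|` [set w | forall i, neg (Y i w)].
Proof. by apply/seteqP; split => w /notin_hull1P. Qed.

Let measurable_all A : measurable A -> measurable [set w | forall i, A (Y i w)].
Proof.
move=> mA; rewrite (_ : [set _ | _] = \bigcap_(i in setT) (Y i @^-1` A)).
  by apply: fin_bigcap_measurable => // i _; exact: measurable_funPTI.
by apply/seteqP; split => w h i; [move=> _|]; exact: h.
Qed.

Lemma measurable_not_hull1 : measurable [set w | ~ convex_hull (fun i => Y i w) 0].
Proof.
by rewrite not_hull1E; apply: measurableU; apply: measurable_all;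
  [exact: measurable_pos|exact: measurable_neg].
Qed.

Lemma not_hull1_prob : P [set w | ~ convex_hull (fun i => Y i w) 0] =
  (pos_mass ^+ m.+2 + (1 - pos_mass) ^+ m.+2)%:E.
Proof.
have mp := measurable_all measurable_pos; have mn := measurable_all measurable_neg.
rewrite not_hull1E measureU //; last first.
  apply/seteqP; split => // w [/(_ ord0) p /(_ ord0) q].
  by have := lt_trans p q; rewrite ltxx.
have allE A : measurable A ->
    P [set w | forall i, A (Y i w)] = (\prod_(i < m.+2) mu A)%E.
  by move=> mA; exact: iid_law_prod iidY (fun=> mA).
rewrite [X in (X + _)%E](allE _ measurable_pos) [X in (_ + X)%E](allE _ measurable_neg).
by rewrite pos_massE neg_massE !prodEFin !prodr_const !card_ord -EFinD.
Qed.

End line_law.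

Lemma pow_binary_gap (R : realType) m (p : R) : 0 <= p <= 1 ->
  2 * 2^-1 ^+ m.+2 + 2 * 2^-1 ^+ m * (p - 2^-1) ^+ 2 <= p ^+ m.+2 + (1 - p) ^+ m.+2.
Proof.
move=> /andP[p0 p1]; have b0 : 0 <= 2^-1 :> R by rewrite invr_ge0.
have q0 : 0 <= 1 - p by rewrite subr_ge0.
have := pow_tangent_gap m p0 b0; have := pow_tangent_gap m q0 b0.
have -> : (1 - p - 2^-1) ^+ 2 = (p - 2^-1) ^+ 2 :> R.
  have -> : 1 - p - 2^-1 = - (p - 2^-1) :> R by lra.
  exact: sqrrN.
rewrite -[m.+2%:R]natr1 ![2^-1 ^+ m.+2]exprS ![2^-1 ^+ m.+1]exprS.
set c := 2^-1 ^+ m; set r := p ^+ m.+2; set r' := (1 - p) ^+ m.+2.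
set v := (p - 2^-1) ^+ 2; set M := m.+1%:R => h1 h2.
lra.
Qed.

(** * Comparison with the uniform law *)

Section comparison.
Variables (R : realType) (k n : nat).

Lemma iid_copies_law dX (TX : measurableType dX) (PX : probability TX R)
    (X : {RV PX >-> 'rV[R]_k}) d (T : measurableType d) (P : probability T R)
    (Xs : 'I_n -> {RV P >-> 'rV[R]_k}) :
  iid_copies PX X P Xs -> iid_law (distribution PX X) Xs.
Proof. by case. Qed.

Lemma hull_probE d (T : measurableType d) (P : probability T R)
    (Y : 'I_n -> {RV P >-> 'rV[R]_k}) (c : R) :
  measurable [set w | ~ convex_hull (fun i => Y i w) 0] ->
  P [set w | ~ convex_hull (fun i => Y i w) 0] = c%:E ->
  P [set w | convex_hull (fun i => Y i w) 0] = (1 - c)%:E.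
Proof.
move=> mN Nc; rewrite EFinB -Nc -probability_setC //; congr (P _).
by apply/seteqP; split => w /=; [move=> h nh; exact: nh|exact: contrapT].
Qed.

End comparison.

Lemma planar_comparison (R : realType) m (mu nu : probability 'rV[R]_2 R)
    d (T : measurableType d) (P : probability T R) (Y : 'I_m.+3 -> {RV P >-> 'rV[R]_2})
    d' (T' : measurableType d') (Q : probability T' R)
    (Z : 'I_m.+3 -> {RV Q >-> 'rV[R]_2}) :
  null_lines mu -> null_lines nu -> (forall x, x != 0 -> left_mass nu x = 2^-1) ->
  iid_law mu Y -> iid_law nu Z ->
  (P [set w | convex_hull (fun i => Y i w) 0%R] <=
   Q [set w | convex_hull (fun i => Z i w) 0%R])%E /\
  (P [set w | convex_hull (fun i => Y i w) 0] =
   Q [set w | convex_hull (fun i => Z i w) 0] <->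
   forall A, measurable A ->
     mu [set y | A (sphere_proj y)] = mu [set y | A (- sphere_proj y)]).
Proof.
move=> mu0 nu0 nu_half iidY iidZ.
have nuE : (\int[nu]_x (left_mass nu x ^+ m.+2)%:E = (2^-1 ^+ m.+2)%:E)%E.
  by apply/(left_mass_moment_eq nu0); apply: filterS (ae_neq0 nu0).
have b0 : 0 <= 2^-1 :> R by rewrite invr_ge0.
set I := (\int[mu]_x (left_mass mu x ^+ m.+2)%:E)%E.
have IE : I = (fine I)%:E by rewrite fineK //; exact: left_massX_fin_num.
have I_ge : 2^-1 ^+ m.+2 <= fine I.
  rewrite -lee_fin -IE; apply: le_trans (left_mass_moment_gap mu0 m).
  rewrite leeDl // mule_ge0 ?lee_fin ?exprn_ge0 //.
  by apply: integral_ge0 => x _; rewrite lee_fin sqr_ge0.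
have I_eq : fine I = 2^-1 ^+ m.+2 <-> forall A, measurable A ->
     mu [set y | A (sphere_proj y)] = mu [set y | A (- sphere_proj y)].
  split=> [Ib|sym].
    apply: sphere_proj_symmetric => //; apply: ae_left_mass_half => //.
    by apply/(left_mass_moment_eq mu0 m); rewrite -/I IE Ib.
  apply: EFin_inj; rewrite -IE; apply/(left_mass_moment_eq mu0 m).
  by apply: filterS (ae_neq0 mu0) => x; exact: symmetric_left_mass.
have n0 : 0 < m.+3%:R :> R by [].
rewrite (hull_probE (c := m.+3%:R * fine I) (measurable_not_hull Y)); last first.
  by rewrite (not_hull_prob mu0 iidY) -/I IE EFinM.
rewrite (hull_probE (c := m.+3%:R * 2^-1 ^+ m.+2) (measurable_not_hull Z)); last first.
  by rewrite (not_hull_prob nu0 iidZ) nuE EFinM.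
split; first by rewrite lee_fin lerD2l lerN2 ler_pM2l.
rewrite -I_eq; split => [[] /addrI /oppr_inj /mulfI|->] //.
by apply; rewrite gt_eqF.
Qed.

Lemma line_comparison (R : realType) m (mu nu : probability 'rV[R]_1 R)
    d (T : measurableType d) (P : probability T R) (Y : 'I_m.+2 -> {RV P >-> 'rV[R]_1})
    d' (T' : measurableType d') (Q : probability T' R)
    (Z : 'I_m.+2 -> {RV Q >-> 'rV[R]_1}) :
  mu [set v | v ord0 ord0 = 0] = 0%E -> nu [set v | v ord0 ord0 = 0] = 0%E ->
  pos_mass nu = 2^-1 -> iid_law mu Y -> iid_law nu Z ->
  (P [set w | convex_hull (fun i => Y i w) 0%R] <=
   Q [set w | convex_hull (fun i => Z i w) 0%R])%E /\
  (P [set w | convex_hull (fun i => Y i w) 0] =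
   Q [set w | convex_hull (fun i => Z i w) 0] <->
   forall A, measurable A ->
     mu [set y | A (sphere_proj y)] = mu [set y | A (- sphere_proj y)]).
Proof.
move=> mu0 nu0 nu_half iidY iidZ; rewrite (symmetric_line mu0).
rewrite (hull_probE (measurable_not_hull1 Y) (not_hull1_prob mu0 iidY)).
rewrite (hull_probE (measurable_not_hull1 Z) (not_hull1_prob nu0 iidZ)) nu_half.
have gap := pow_binary_gap m (pos_mass01 mu); set p := pos_mass mu in gap *.
have -> : 1 - 2^-1 = 2^-1 :> R by lra.
have c0 : 0 < 2^-1 ^+ m :> R by rewrite exprn_gt0 // invr_gt0.
have v0 := sqr_ge0 (p - 2^-1).
have cv := mulr_ge0 (ltW c0) v0.
split; first by rewrite lee_fin; lra.
split=> [[e]|->]; last by congr (EFin (1 - (_ + _ ^+ _))); lra.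
have /eqP : (p - 2^-1) ^+ 2 = 0.
  apply/eqP; rewrite eq_le v0 andbT -(pmulr_rle0 _ c0); lra.
by rewrite sqrf_eq0 subr_eq0 => /eqP.
Qed.

Section uniform_pair.
Variables (R : realType) (nu : probability 'rV[R]_1 R).
Hypothesis nu_law : forall A, measurable A -> nu A = @sphere_law R 1 A.

Lemma uniform_null_origin : nu [set v | v ord0 ord0 = 0] = 0%E.
Proof.
rewrite nu_law; last exact: measurable_zero.
have origin_off (c : R) : c != 0 -> ~ [set v : 'rV[R]_1 | v ord0 ord0 = 0] (const_mx c).
  by rewrite /= mxE => /eqP.
rewrite /sphere_law !diracE (memNset (origin_off 1 _)) ?oner_eq0 //.
by rewrite (memNset (origin_off (-1) _)) ?oppr_eq0 ?oner_eq0 // !mule0 adde0.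
Qed.

Lemma uniform_pos_mass : pos_mass nu = 2^-1.
Proof.
rewrite /pos_mass nu_law; last exact: measurable_pos.
have p1 : pos (const_mx 1 : 'rV[R]_1) by rewrite /pos /= mxE ltr01.
have n1 : ~ pos (const_mx (-1) : 'rV[R]_1) by rewrite /pos /= mxE ltr0N1.
by rewrite /sphere_law !diracE (mem_set p1) (memNset n1) mule0 adde0 mule1.
Qed.

End uniform_pair.

Theorem theorem1 (R : realType) (k n : nat) (hk : k = 1%N \/ k = 2%N)
    (hn : (k < n)%N)
    (dX : measure_display) (TX : measurableType dX) (PX : probability TX R)
    (X : {RV PX >-> 'rV[R]_k}) (hX : continuous_random_vector PX X)
    (dXs : measure_display) (TXs : measurableType dXs)
    (PXs : probability TXs R) (Xs : 'I_n -> {RV PXs >-> 'rV[R]_k})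
    (hXs : iid_copies PX X PXs Xs)
    (dU : measure_display) (TU : measurableType dU) (PU : probability TU R)
    (U : {RV PU >-> 'rV[R]_k}) (hU : uniform_on_sphere PU U)
    (dUs : measure_display) (TUs : measurableType dUs)
    (PUs : probability TUs R) (Us : 'I_n -> {RV PUs >-> 'rV[R]_k})
    (hUs : iid_copies PU U PUs Us) :
  (PXs [set w | convex_hull (fun i => Xs i w) 0%R]
     <= PUs [set w | convex_hull (fun i => Us i w) 0%R])%E /\
  (PXs [set w | convex_hull (fun i => Xs i w) 0%R]
     = PUs [set w | convex_hull (fun i => Us i w) 0%R] <->
   symmetric_law PX (fun w => sphere_proj (X w))).
Proof.
have lawX := iid_copies_law hXs; have lawU := iid_copies_law hUs.
case: hk => ?; subst k.
  case: n => [|[|m]] // in hn Xs hXs Us hUs lawX lawU *.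
  apply: (line_comparison _ _ _ lawX lawU).
  - exact: continuous_null hX (@measurable_zero R) (lebesgue_rV1_set1 0).
  - exact: uniform_null_origin hU.
  - exact: uniform_pos_mass hU.
case: n => [|[|[|m]]] // in hn Xs hXs Us hUs lawX lawU *.
apply: (planar_comparison _ _ _ lawX lawU).
- exact: continuous_null_lines.
- exact: uniform_null_lines hU.
- exact: uniform_left_mass hU.
Qed.
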